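(* Let $U$ be a Vaught theory. Then $U$ is $N$-Enayat for some interpretation $N$ of ${\sf Succ}_0$ in $U$ iff $U$ interprets $U+{\sf TB}^-_N$ for some interpretation $N$ of ${\sf R}$ in $U$. Moreover, such an $N$ can be taken to have dimension equal to the dimension of the direct interpretation of ${\sf VS}$ in $U$ that witnesses that $U$ is Vaught.
   Context: ${\sf Succ}_0$ has a constant $0$ and binary predicate ${\sf S}$; with $\widetilde0(x):=(x=0)$, $\widetilde{n+1}(x):=\exists y(\widetilde n(y)\wedge y\,{\sf S}\,x)$, its axioms are $\exists x\,\widetilde n(x)$, $\neg(\widetilde m(x)\wedge\widetilde n(x))$ for $m<n$, $(\widetilde n(x)\wedge\widetilde n(y))\to x=y$. ${\sf R}$ is the Tarski–Mostowski–Robinson weak arithmetic; an interpretation of ${\sf R}$ yields one of ${\sf Succ}_0$ by reading $x\,{\sf S}\,y$ as ${\sf S}x=y$, and ${\sf TB}^-_N$ for an interpretation $N$ of ${\sf R}$ is taken w.r.t. this induced interpretation of ${\sf Succ}_0$. For an interpretation $N$ of ${\sf Succ}_0$ in $U$ with domain $\delta_N$, ${\sf T}(\underline n)$ abbreviates $\exists\vec x\in\delta_N(\widetilde n^N(\vec x)\wedge{\sf T}(\vec x))$ for a fresh predicate ${\sf T}$, and ${\sf TB}^-_N$ is the set of $A\leftrightarrow{\sf T}(\underline{\ulcorner A\urcorner})$ for $U$-sentences $A$ (standard Gödel numbering). $U$ is $N$-Enayat iff $U$ interprets $U+{\sf TB}^-_N$. $U$ is Vaught iff it directly (unrelativized,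 identity-preserving, possibly multidimensional) interprets ${\sf VS}$, the theory with $\exists x\forall y\,y\notin x$ and, for each $n$, $\forall u_0\dots u_{n-1}\exists x\forall y(y\in x\leftrightarrow\bigvee_{i<n}y=u_i)$. *)

(* Defs.v *)
From HB Require Import structures.
From mathcomp Require Import all_boot.
From mathcomp Require Import classical_sets.

Set Implicit Arguments.
Unset Strict Implicit.
Unset Printing Implicit Defensive.

Local Open Scope classical_set_scope.
Local Open Scope nat_scope.

(* Constants are function symbols of arity 0.  The [countType] structure on the
   symbols is what the Goedel numbering is computed from. *)
Record signature := Signature {
  fsym : countType;
  rsym : countType;
  far : fsym -> nat;
  rar : rsym -> nat }.

(* De Bruijn indices: index 0 is bound by the innermost quantifier. *)
Inductive term (L : signature) : Type :=
| Var of nat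
| Fun (f : fsym L) of ('I_(far f) -> term L).

Inductive form (L : signature) : Type :=
| Fal
| Eq of term L & term L
| Rel (r : rsym L) of ('I_(rar r) -> term L)
| Imp of form L & form L
| All of form L.

Arguments Var {L}.
Arguments Fal {L}.

Section Syntax.
Variable L : signature.
Implicit Types (t : term L) (phi psi : form L).

Definition Not phi := Imp phi Fal.
Definition Top : form L := Not Fal.
Definition And phi psi := Not (Imp phi (Not psi)).
Definition Or phi psi := Imp (Not phi) psi.
Definition Iff phi psi := And (Imp phi psi) (Imp psi phi).
Definition Ex phi := Not (All (Not phi)).
Definition alls (n : nat) phi := iter n (@All L) phi.
Definition exs (n : nat) phi := iter n Ex phi.

Fixpoint subst_term (s : nat -> term L) t : term L :=
  match t with
  | Var i => s i
  | Fun f ts => Fun (fun j => subst_term s (ts j))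
  end.

Definition shift t : term L := subst_term (fun i => Var i.+1) t.

Definition scons t (s : nat -> term L) (i : nat) : term L :=
  if i is j.+1 then s j else t.

Fixpoint subst (s : nat -> term L) phi : form L :=
  match phi with
  | Fal => Fal
  | Eq t u => Eq (subst_term s t) (subst_term s u)
  | Rel r ts => Rel (fun j => subst_term s (ts j))
  | Imp phi psi => Imp (subst s phi) (subst s psi)
  | All phi => All (subst (scons (Var 0) (fun i => shift (s i))) phi)
  end.

Definition shift_form phi := subst (fun i => Var i.+1) phi.
Definition inst phi t := subst (scons t Var) phi.
Definition rename (r : nat -> nat) phi := subst (fun i => Var (r i)) phi.

Fixpoint term_below (k : nat) t : bool :=
  match t with
  | Var i => i < k
  | Fun f ts => [forall j, term_below k (ts j)]
  end.

(* All free variables of the formula are among [Var 0], ..., [Var k.-1]. *)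
Fixpoint below (k : nat) phi : bool :=
  match phi with
  | Fal => true
  | Eq t u => term_below k t && term_below k u
  | Rel r ts => [forall j, term_below k (ts j)]
  | Imp phi psi => below k phi && below k psi
  | All phi => below k.+1 phi
  end.

Definition sentence : set (form L) := [set phi | below 0 phi].

Inductive prv : set (form L) -> form L -> Prop :=
| prv_ax T phi : T phi -> prv T phi
| prv_impI T phi psi : prv (T `|` [set phi]) psi -> prv T (Imp phi psi)
| prv_impE T phi psi : prv T (Imp phi psi) -> prv T phi -> prv T psi
| prv_raa T phi : prv (T `|` [set Not phi]) Fal -> prv T phi
| prv_allI T phi : prv (shift_form @` T) phi -> prv T (All phi)
| prv_allE T phi t : prv T (All phi) -> prv T (inst phi t)
| prv_eqI T t : prv T (Eq t t)
| prv_eqE T phi t u : prv T (Eq t u) -> prv T (inst phi t) -> prv T (inst phi u).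

(* A formula is written as a word in Polish notation, each symbol being a
   number, and the word is then coded by mathcomp's bijection [CodeSeq.code]
   between [seq nat] and [nat]. *)
Fixpoint term_word t : seq nat :=
  match t with
  | Var i => [:: 4 + 3 * i]
  | Fun f ts => 5 + 3 * pickle f :: flatten [seq term_word (ts j) | j <- enum 'I_(far f)]
  end.

Fixpoint form_word phi : seq nat :=
  match phi with
  | Fal => [:: 0]
  | Eq t u => 1 :: term_word t ++ term_word u
  | Imp phi psi => 2 :: form_word phi ++ form_word psi
  | All phi => 3 :: form_word phi
  | Rel r ts => 6 + 3 * pickle r :: flatten [seq term_word (ts j) | j <- enum 'I_(rar r)]
  end.

Definition godel phi : nat := CodeSeq.code (form_word phi).

End Syntax.

Arguments Top {L}.
Arguments prv {L}.

(* An object of the source language is a [dim]-tuple of the target language.  In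
   target formulas the variables are grouped in blocks: component [c] of block
   [b] is [Var (b * dim + c)].  [dom] speaks about block 0 and [eqn] about blocks
   0 and 1; in [rel r] block [j] is argument [j]; in [fct f], the graph of [f],
   block [j < far f] is argument [j] and block [far f] is the value. *)
Record translation (L K : signature) := Translation {
  dim : nat;
  dom : form K;
  eqn : form K;
  fct : fsym L -> form K;
  rel : rsym L -> form K }.

Section Translation.
Variables (L K : signature) (tau : translation L K).
Local Notation d := (dim tau).

(* The bounds exclude parameters. *)
Definition translation_wf : Prop :=
  [/\ 0 < d, below d (dom tau), below (2 * d) (eqn tau),
      forall f, below ((far f).+1 * d) (fct tau f)
    & forall r, below (rar r * d) (rel tau r)].

Definition rename_blocks (a : nat -> nat) (phi : form K) : form K :=
  rename (fun v => a (v %/ d) * d + v %% d) phi.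

Definition eq_blocks (i j : nat) : form K :=
  \big[@And K/Top]_(c < d) Eq (Var (i * d + c)) (Var (j * d + c)).

(* Binds [n] new blocks of the domain, with block numbers 0, ..., [n.-1]; the
   numbers of the old blocks increase by [n]. *)
Definition ex_blocks (n : nat) (phi : form K) : form K :=
  exs (n * d) (And (\big[@And K/Top]_(j < n) rename_blocks (fun=> val j) (dom tau)) phi).

(* "Block [y] is a value of [t]", where [Var i] of [t] is read as block [i + k]. *)
Fixpoint tr_term (k : nat) (t : term L) (y : nat) : form K :=
  match t with
  | Var i => eq_blocks (i + k) y
  | Fun f ts =>
      let n := far f in
      ex_blocks n
        (And (\big[@And K/Top]_(j < n) tr_term (k + n) (ts j) j)
             (rename_blocks (fun b => if b < n then b else y + n) (fct tau f)))
  end.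

(* Atoms are unravelled: P(t_0, ..., t_{n-1}) is read as the existence of values
   z_j of the t_j with P(z_0, ..., z_{n-1}). *)
Fixpoint tr (phi : form L) : form K :=
  match phi with
  | Fal => Fal
  | Eq t u => ex_blocks 2 (And (And (tr_term 2 t 0) (tr_term 2 u 1)) (eqn tau))
  | Rel r ts =>
      let n := rar r in
      ex_blocks n (And (\big[@And K/Top]_(j < n) tr_term n (ts j) j) (rel tau r))
  | Imp phi psi => Imp (tr phi) (tr psi)
  | All phi => alls d (Imp (dom tau) (tr phi))
  end.

(* [tau] is an interpretation of [V] in [U].  Quantifying over all theorems of
   [V] makes [U] prove, in particular, that the domain is nonempty, that [eqn] is
   a congruence on it and that each [fct f] is functional up to [eqn]. *)
Definition interpretation (V : set (form L)) (U : set (form K)) : Prop :=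
  translation_wf /\
  forall phi, sentence phi -> prv V phi -> prv U (tr phi).

Definition direct (U : set (form K)) : Prop :=
  prv U (alls d (dom tau)) /\
  prv U (alls (2 * d) (Iff (eqn tau) (eq_blocks 0 1))).

End Translation.

Definition interprets (K L : signature) (U : set (form K)) (V : set (form L)) : Prop :=
  exists tau : translation L K, interpretation tau V U.

Definition args (L : signature) (n : nat) (s : seq (term L)) : 'I_n -> term L :=
  fun j => nth (Var 0) s j.

Definition sig_Succ0 : signature :=
  @Signature unit unit (fun=> 0) (fun=> 2).

Definition zero0 : term sig_Succ0 := @Fun sig_Succ0 tt (args [::]).
Definition S0 (t u : term sig_Succ0) : form sig_Succ0 :=
  @Rel sig_Succ0 tt (args [:: t; u]).

(* The formula n~(x) for x the variable [Var i]. *)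
Fixpoint ntilde (n i : nat) : form sig_Succ0 :=
  if n is m.+1 then Ex (And (ntilde m 0) (S0 (Var 0) (Var i.+1)))
  else Eq (Var i) zero0.

Inductive Succ0 : set (form sig_Succ0) :=
| Succ0_ex n : Succ0 (Ex (ntilde n 0))
| Succ0_neq m n : m < n -> Succ0 (All (Not (And (ntilde m 0) (ntilde n 0))))
| Succ0_uniq n :
    Succ0 (All (All (Imp (And (ntilde n 1) (ntilde n 0)) (Eq (Var 1) (Var 0))))).

Inductive fsym_R := Zero_R | Succ_R | Add_R | Mul_R.

Definition fsym_R_to (f : fsym_R) : nat :=
  match f with Zero_R => 0 | Succ_R => 1 | Add_R => 2 | Mul_R => 3 end.
Definition fsym_R_of (n : nat) : option fsym_R :=
  nth None [:: Some Zero_R; Some Succ_R; Some Add_R; Some Mul_R] n.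
Lemma fsym_R_toK : pcancel fsym_R_to fsym_R_of. Proof. by case. Qed.
HB.instance Definition _ := Countable.copy fsym_R (pcan_type fsym_R_toK).

Definition far_R (f : fsym_R) : nat :=
  match f with Zero_R => 0 | Succ_R => 1 | Add_R | Mul_R => 2 end.

Definition sig_R : signature :=
  @Signature fsym_R void far_R (fun=> 0).

Definition zeroR : term sig_R := @Fun sig_R Zero_R (args [::]).
Definition succR (t : term sig_R) : term sig_R := @Fun sig_R Succ_R (args [:: t]).
Definition addR (t u : term sig_R) : term sig_R := @Fun sig_R Add_R (args [:: t; u]).
Definition mulR (t u : term sig_R) : term sig_R := @Fun sig_R Mul_R (args [:: t; u]).
Definition numR (n : nat) : term sig_R := iter n succR zeroR.

(* Order is not primitive in R: t <= u abbreviates exists z, z + t = u. *)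
Definition leR (t u : term sig_R) : form sig_R :=
  Ex (Eq (addR (Var 0) (shift t)) (shift u)).

Inductive TheoryR : set (form sig_R) :=
| R_add m n : TheoryR (Eq (addR (numR m) (numR n)) (numR (m + n)))
| R_mul m n : TheoryR (Eq (mulR (numR m) (numR n)) (numR (m * n)))
| R_neq m n : m != n -> TheoryR (Not (Eq (numR m) (numR n)))
| R_le n :
    TheoryR (All (Imp (leR (Var 0) (numR n))
                      (\big[@Or _/Fal]_(i < n.+1) Eq (Var 0) (numR i))))
| R_total n : TheoryR (All (Or (leR (Var 0) (numR n)) (leR (numR n) (Var 0)))).

Definition sig_VS : signature :=
  @Signature void unit (fun=> 0) (fun=> 2).

Definition Mem (t u : term sig_VS) : form sig_VS :=
  @Rel sig_VS tt (args [:: t; u]).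

Inductive VS : set (form sig_VS) :=
| VS_empty : VS (Ex (All (Not (Mem (Var 0) (Var 1)))))
| VS_set n :
    VS (alls n (Ex (All (Iff (Mem (Var 0) (Var 1))
                             (\big[@Or _/Fal]_(i < n) Eq (Var 0) (Var i.+2)))))).

Definition Vaught_witness (L : signature) (U : set (form L))
    (K : translation sig_VS L) : Prop :=
  interpretation K VS U /\ direct K U.

Definition Vaught (L : signature) (U : set (form L)) : Prop :=
  exists K, Vaught_witness U K.

(* Composition with the reading of x S y as Sx = y. *)
Definition induced (L : signature) (N : translation sig_R L) : translation sig_Succ0 L :=
  {| dim := dim N;
     dom := dom N;
     eqn := eqn N;
     fct := fun=> fct N Zero_R;
     rel := fun=> tr N (Eq (succR (Var 0)) (Var 1)) |}.

Section TB.
Variables (L : signature) (N : translation sig_Succ0 L).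

(* [None] is the fresh predicate T, whose arity is the dimension of N. *)
Definition sig_T : signature :=
  @Signature (fsym L) (option (rsym L)) (@far L)
    (fun r => if r is Some r' then rar r' else dim N).

Fixpoint emb_term (t : term L) : term sig_T :=
  match t with
  | Var i => Var i
  | Fun f ts => @Fun sig_T f (fun j => emb_term (ts j))
  end.

Fixpoint emb (phi : form L) : form sig_T :=
  match phi with
  | Fal => Fal
  | Eq t u => Eq (emb_term t) (emb_term u)
  | Rel r ts => @Rel sig_T (Some r) (fun j => emb_term (ts j))
  | Imp phi psi => Imp (emb phi) (emb psi)
  | All phi => All (emb phi)
  end.

Definition truth (n : nat) : form sig_T :=
  exs (dim N)
    (And (And (emb (dom N)) (emb (tr N (ntilde n 0))))
         (@Rel sig_T None (fun c => Var c))).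

Definition TB : set (form sig_T) :=
  [set Iff (emb A) (truth (godel A)) | A in @sentence L].

Definition add_TB (U : set (form L)) : set (form sig_T) := emb @` U `|` TB.

End TB.

Arguments TB {L} N.
Arguments add_TB {L} N U.

Definition Enayat (L : signature) (U : set (form L)) (N : translation sig_Succ0 L) : Prop :=
  interprets U (add_TB N U).

(* Main.v *)
(* By soundness and completeness it suffices to argue inside a model M of U, where
   the given direct interpretation of VS provides all finite sets of d-tuples.  The
   number n is represented by any pair <x, x> such that x has n elements, up to the
   existence of injections both ways; adding pairs <t, x> with t <> x, and making
   addition and multiplication total by fiat, yields an interpretation N* of R whose
   elements equal to the numeral n are exactly the representatives of n.  From a
   truth predicate T on N we obtain one on N*: T*(y) holds if some g in N with T(g) is
   certified, by a set of pairs closed under predecessors, to have as many steps as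
   y.  For y = n, induction on n outside M shows that such a g satisfies n~ in N, so
   no induction in U is needed. *)

(* An interpretation of Succ0 carries no arithmetic, and its dimension is unrelated to that of VS.
   The numbers are therefore rebuilt from the d-tuples themselves, which fixes the dimension of N*.
   The obstacle is the weakness of VS: there is no extensionality, so a pair has many codes;
   infinite sets may behave arbitrarily; and injections between them need not compose. Hence nothing
   is expected of nonstandard elements. Equality on N* is made an equivalence by definition, the
   operations are forced to respect it, and values are computed for numerals only. Just the two
   order axioms of R reach beyond the numerals, and they dictate both the tagged pairs and the
   choice of the junk values.

   The formula n~ grows with n, so no single formula in y can say that g satisfies n~ when y is n.
   Certificates make the length of the chain an object of the model. The given interpretation of U +
   TB is kept as it is, except that T is sent to the translation of the formula T*. *)
Require Import Defs.
From mathcomp Require Import all_boot.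
From mathcomp Require Import boolp classical_sets.
(* MathComp also defines [fsym] and [rel]. *)
Import Defs.

Set Implicit Arguments.
Unset Strict Implicit.
Unset Printing Implicit Defensive.

Local Open Scope classical_set_scope.
Local Open Scope nat_scope.

(** * Soundness and completeness *)

Section Substitution.
Variable L : signature.
Implicit Types (t : term L) (phi psi : form L) (s r : nat -> term L).

Definition up s : nat -> term L := scons (Var 0) (fun i => shift (s i)).

Lemma subst_term_comp s r t :
  subst_term s (subst_term r t) = subst_term (fun i => subst_term s (r i)) t.
Proof. by elim: t => //= f ts IH; congr Fun; apply/funext => j. Qed.

Lemma up_comp s r :
  (fun i => subst_term (up s) (up r i)) = up (fun i => subst_term s (r i)).
Proof. by apply/funext => -[|i] //=; rewrite /shift !subst_term_comp. Qed.

Lemma subst_comp s r phi :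
  subst s (subst r phi) = subst (fun i => subst_term s (r i)) phi.
Proof.
elim: phi s r => //= [t u|p ts|phi IH1 psi IH2|phi IH] s r.
- by rewrite !subst_term_comp.
- by congr Rel; apply/funext => j; rewrite subst_term_comp.
- by rewrite IH1 IH2.
- by rewrite -/(up s) -/(up r) IH up_comp.
Qed.

Lemma subst_term_below k s r t :
  (forall i, i < k -> s i = r i) -> term_below k t -> subst_term s t = subst_term r t.
Proof.
move=> sr; elim: t => [i /sr //|f ts IH] /= /forallP tk.
by congr Fun; apply/funext => j; apply: IH.
Qed.

Lemma subst_below k s r phi :
  (forall i, i < k -> s i = r i) -> below k phi -> subst s phi = subst r phi.
Proof.
elim: phi k s r => //= [t u|p ts|phi IH1 psi IH2|phi IH] k s r sr.
- by case/andP=> tk uk; rewrite !(subst_term_below sr).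
- by move=> /forallP tk; congr Rel; apply/funext => j; exact: (subst_term_below sr (tk j)).
- by case/andP=> pk qk; rewrite (IH1 k _ r) ?(IH2 k _ r).
- by move=> pk; rewrite (IH k.+1 _ (up r)) // => -[|i] //= /sr ->.
Qed.

Lemma subst_term_id t : subst_term Var t = t.
Proof. by elim: t => //= f ts IH; congr Fun; apply/funext. Qed.

Lemma up_id : up Var = Var.
Proof. by apply/funext => -[]. Qed.

Lemma subst_id phi : subst Var phi = phi.
Proof.
elim: phi => //= [t u|p ts|phi -> psi -> //|phi IH].
- by rewrite !subst_term_id.
- by congr Rel; apply/funext => j; rewrite subst_term_id.
- by rewrite -[scons _ _]/(up Var) up_id IH.
Qed.

Lemma shift_up s phi : subst (up s) (shift_form phi) = shift_form (subst s phi).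
Proof. by rewrite /shift_form !subst_comp. Qed.

Lemma subst_inst s phi t : subst s (inst phi t) = inst (subst (up s) phi) (subst_term s t).
Proof.
rewrite /inst !subst_comp; congr subst; apply/funext => -[|i] //=.
by rewrite /shift subst_term_comp /= subst_term_id.
Qed.

Lemma inst_up s phi t : inst (subst (up s) phi) t = subst (scons t s) phi.
Proof.
rewrite /inst subst_comp; congr subst; apply/funext => -[|i] //=.
by rewrite /shift subst_term_comp /= subst_term_id.
Qed.

Lemma term_below_le k m t : k <= m -> term_below k t -> term_below m t.
Proof.
move=> km; elim: t => /= [i|f ts IH]; first by move/leq_trans; apply.
by move=> /forallP h; apply/forallP => j; apply: IH.
Qed.

Lemma below_le k m phi : k <= m -> below k phi -> below m phi.
Proof.
elim: phi k m => //= [t u|p ts|phi IH1 psi IH2|phi IH] k m km.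
- by case/andP=> *; rewrite !(term_below_le km).
- by move=> /forallP h; apply/forallP => j; apply: term_below_le (h j).
- by case/andP=> *; rewrite (IH1 k) // (IH2 k).
- exact: IH.
Qed.

Lemma term_below_ex t : exists k, term_below k t.
Proof.
elim: t => [i|f ts /choice[k kP]]; first by exists i.+1 => /=.
exists (\max_j k j); apply/forallP => j.
exact/term_below_le/kP/(@leq_bigmax _ k).
Qed.

Lemma below_ex phi : exists k, below k phi.
Proof.
elim: phi => [|t u|r ts|phi [k kP] psi [m mP]|phi [k kP]].
- by exists 0.
- have [k kP] := term_below_ex t; have [m mP] := term_below_ex u.
  exists (maxn k m) => /=.
  by rewrite (term_below_le (leq_maxl k m)) // (term_below_le (leq_maxr k m)).
- have [k kP] := choice (fun j => term_below_ex (ts j)).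
  exists (\max_j k j); apply/forallP => j.
  exact/term_below_le/kP/(@leq_bigmax _ k).
- exists (maxn k m) => /=.
  by rewrite (below_le (leq_maxl k m)) // (below_le (leq_maxr k m)).
- by exists k => /=; apply: below_le kP.
Qed.

Lemma term_below_subst k m s t :
  (forall i, i < k -> term_below m (s i)) -> term_below k t -> term_below m (subst_term s t).
Proof.
move=> h; elim: t => [i|f ts IH] /=; first exact: h.
by move=> /forallP tk; apply/forallP => j; apply: IH.
Qed.

Lemma below_subst k m s phi :
  (forall i, i < k -> term_below m (s i)) -> below k phi -> below m (subst s phi).
Proof.
elim: phi k m s => //= [t u|p ts|phi IH1 psi IH2|phi IH] k m s h.
- by case/andP=> *; rewrite !(term_below_subst h).
- by move=> /forallP tk; apply/forallP => j; apply: term_below_subst (tk j).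
- by case/andP=> *; rewrite (IH1 k) // (IH2 k).
- apply: IH => -[|i] //= /h; apply: term_below_subst => j jm; exact: jm.
Qed.

End Substitution.

Section Provability.
Variable L : signature.
Implicit Types (T : set (form L)) (t : term L) (phi psi : form L).

Lemma prv_weak T T' phi : T `<=` T' -> prv T phi -> prv T' phi.
Proof.
move=> TT' h; elim: h T' TT' => {T phi}.
- by move=> T phi Tp T' TT'; apply/prv_ax/TT'.
- by move=> T phi psi _ IH T' TT'; apply/prv_impI/IH/setSU.
- by move=> T phi psi _ IH1 _ IH2 T' TT'; apply: (@prv_impE _ _ phi); auto.
- by move=> T phi _ IH T' TT'; apply/prv_raa/IH/setSU.
- by move=> T phi _ IH T' TT'; apply/prv_allI/IH/image_subset.
- by move=> T phi t _ IH T' TT'; apply/prv_allE/IH.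
- by move=> *; apply: prv_eqI.
- by move=> T phi t u _ IH1 _ IH2 T' TT'; apply: (@prv_eqE _ _ _ t); auto.
Qed.

Lemma prv_subst T phi s : prv T phi -> prv (subst s @` T) (subst s phi).
Proof.
move=> h; elim: h s => {T phi}.
- by move=> T phi Tp s; apply/prv_ax; exists phi.
- by move=> T phi psi _ IH s; apply: prv_impI; rewrite -image_set1 -image_setU.
- by move=> T phi psi _ IH1 _ IH2 s; apply: (prv_impE (IH1 s)); apply: IH2.
- move=> T phi _ IH s; apply: prv_raa.
  by rewrite -[Not _]/(subst s (Not phi)) -image_set1 -image_setU.
- move=> T phi _ IH s; apply: prv_allI => /=; rewrite image_comp.
  suff -> : @shift_form L \o subst s = subst (up s) \o @shift_form L.
    by rewrite -image_comp; apply: IH.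
  by apply/funext => psi /=; rewrite shift_up.
- by move=> T phi t _ IH s; rewrite subst_inst; apply/prv_allE/IH.
- by move=> *; apply: prv_eqI.
- move=> T phi t u _ IH1 _ IH2 s; rewrite subst_inst.
  by apply: (@prv_eqE _ _ _ (subst_term s t)); [exact: IH1|rewrite -subst_inst].
Qed.

(** Generalisation over the fresh variable [Var k]. The calculus generalises over index 0 after
    shifting the hypotheses; the renaming that sends k to 0 and each i < k to i + 1 turns the given
    derivation into one of [phi] from the shifted theory. *)
Lemma prv_gen T phi k :
  (forall psi, T psi -> below k psi) -> below k.+1 phi -> prv T (inst phi (Var k)) ->
  prv T (All phi).
Proof.
move=> Tk pk /(prv_subst (fun i => Var (if i < k then i.+1 else 0))) h.
apply: prv_allI; move: h.
rewrite /inst subst_comp (@subst_below _ k.+1 _ Var) ?subst_id //; last first.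
  by case=> [|i] /=; rewrite ?ltnn // ltnS => ->.
apply: prv_weak => _ [psi Tpsi <-]; exists psi => //.
by rewrite /shift_form; apply: (subst_below _ (Tk _ Tpsi)) => i /= ->.
Qed.

Lemma prv_cut T phi psi : prv T phi -> prv (T `|` [set phi]) psi -> prv T psi.
Proof. by move=> h /prv_impI h'; apply: prv_impE h. Qed.

Lemma prv_last T phi : prv (T `|` [set phi]) phi.
Proof. by apply: prv_ax; right. Qed.

Lemma prv_Fal T phi : prv T Fal -> prv T phi.
Proof. by move=> h; apply/prv_raa/prv_weak/h/subsetUl. Qed.

(** Compactness. The chain is quantified after the derivation because the rules extend or shift the
    hypotheses, and the chain has to change along with them. *)
Lemma prv_chain T phi : prv T phi -> forall G : nat -> set (form L),
  (forall m n, m <= n -> G m `<=` G n) -> (forall psi, T psi -> exists n, G n psi) ->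
  exists n, prv (G n) phi.
Proof.
have addG (G : nat -> set (form L)) phi0 (Gm : forall m n, m <= n -> G m `<=` G n) :
    forall m n, m <= n -> G m `|` [set phi0] `<=` G n `|` [set phi0].
  by move=> m n /Gm; apply: setSU.
have joinG (G : nat -> set (form L)) (Gm : forall m n, m <= n -> G m `<=` G n)
    phi1 phi2 : (exists n, prv (G n) phi1) -> (exists n, prv (G n) phi2) ->
    exists n, prv (G n) phi1 /\ prv (G n) phi2.
  move=> [n1 h1] [n2 h2]; exists (maxn n1 n2); split.
    exact/prv_weak/h1/Gm/leq_maxl.
  exact/prv_weak/h2/Gm/leq_maxr.
elim=> {T phi}.
- by move=> T phi Tp G Gm TG; have [n Gn] := TG _ Tp; exists n; apply: prv_ax.
- move=> T phi psi _ IH G Gm TG.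
  have [|chi [/TG[n Gn]|->]|n h] := IH (fun n => G n `|` [set phi]); first exact: addG.
  + by exists n; left.
  + by exists 0; right.
  + by exists n; apply: prv_impI.
- move=> T phi psi _ IH1 _ IH2 G Gm TG.
  have [n [h1 h2]] := joinG _ Gm _ _ (IH1 _ Gm TG) (IH2 _ Gm TG).
  by exists n; apply: prv_impE h2.
- move=> T phi _ IH G Gm TG.
  have [|chi [/TG[n Gn]|->]|n h] := IH (fun n => G n `|` [set Not phi]); first exact: addG.
  + by exists n; left.
  + by exists 0; right.
  + by exists n; apply: prv_raa.
- move=> T phi _ IH G Gm TG.
  have [m n mn|_ [psi /TG[n Gn] <-]|n h] := IH (fun n => @shift_form L @` G n).
  + exact/image_subset/Gm.
  + by exists n; exists psi.
  + by exists n; apply: prv_allI.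
- by move=> T phi t _ IH G Gm TG; have [n h] := IH _ Gm TG; exists n; apply: prv_allE.
- by move=> T t G _ _; exists 0; apply: prv_eqI.
- move=> T phi t u _ IH1 _ IH2 G Gm TG.
  have [n [h1 h2]] := joinG _ Gm _ _ (IH1 _ Gm TG) (IH2 _ Gm TG).
  by exists n; apply: prv_eqE h2.
Qed.

End Provability.

(** * Tarskian semantics and soundness *)

Record struct (L : signature) := Struct {
  car :> Type;
  fi : forall f : fsym L, ('I_(far f) -> car) -> car;
  ri : forall r : rsym L, ('I_(rar r) -> car) -> Prop }.

Definition sc (D : Type) (x : D) (e : nat -> D) (i : nat) : D :=
  if i is j.+1 then e j else x.

Section Satisfaction.
Variables (L : signature) (M : struct L).
Implicit Types (t : term L) (phi psi : form L) (e : nat -> M).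

Fixpoint eval e t : M :=
  match t with
  | Var i => e i
  | Fun f ts => fi (fun j => eval e (ts j))
  end.

Fixpoint sat e phi : Prop :=
  match phi with
  | Fal => False
  | Eq t u => eval e t = eval e u
  | Rel r ts => ri (fun j => eval e (ts j))
  | Imp phi psi => sat e phi -> sat e psi
  | All phi => forall x, sat (sc x e) phi
  end.

Lemma eval_subst e s t : eval e (subst_term s t) = eval (fun i => eval e (s i)) t.
Proof. by elim: t => //= f ts IH; congr fi; apply/funext. Qed.

Lemma eval_sc e s x :
  (fun i => eval (sc x e) (up s i)) = sc x (fun i => eval e (s i)).
Proof. by apply/funext => -[|i] //=; rewrite /shift eval_subst. Qed.

Lemma sat_subst e s phi : sat e (subst s phi) = sat (fun i => eval e (s i)) phi.
Proof.
elim: phi e s => //= [t u|p ts|phi IH1 psi IH2|phi IH] e s.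
- by rewrite !eval_subst.
- by congr ri; apply/funext => j; rewrite eval_subst.
- by rewrite IH1 IH2.
- apply/propext; split=> h x; have := h x; rewrite -/(up s) IH eval_sc //.
Qed.

Lemma sat_inst e phi t : sat e (inst phi t) = sat (sc (eval e t) e) phi.
Proof. by rewrite /inst sat_subst; congr sat; apply/funext => -[]. Qed.

Lemma sat_shift e x phi : sat (sc x e) (shift_form phi) = sat e phi.
Proof. by rewrite /shift_form sat_subst. Qed.

Lemma sat_rename e r phi : sat e (rename r phi) = sat (fun i => e (r i)) phi.
Proof. by rewrite /rename sat_subst. Qed.

Lemma satImp e phi psi : sat e (Imp phi psi) = (sat e phi -> sat e psi). Proof. by []. Qed.

Lemma satAll e phi : sat e (All phi) = forall x, sat (sc x e) phi. Proof. by []. Qed.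

Lemma satNot e phi : sat e (Not phi) = ~ sat e phi. Proof. by []. Qed.

Lemma satTop e : sat e Top. Proof. by []. Qed.

Lemma satAnd e phi psi : sat e (And phi psi) = (sat e phi /\ sat e psi).
Proof.
by apply/propext => /=; have [] := EM (sat e phi); have [] := EM (sat e psi); tauto.
Qed.

Lemma satOr e phi psi : sat e (Or phi psi) = (sat e phi \/ sat e psi).
Proof. by apply/propext => /=; have [] := EM (sat e phi); tauto. Qed.

Lemma satIff e phi psi : sat e (Iff phi psi) = (sat e phi <-> sat e psi).
Proof. by rewrite /Iff satAnd. Qed.

Lemma satEx e phi : sat e (Ex phi) = exists x, sat (sc x e) phi.
Proof.
apply/propext => /=; split=> [h|[x h] /(_ x)]; last by apply.
by apply: contrapT => h'; apply: h => x hx; apply: h'; exists x.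
Qed.

Lemma eval_below k e e' t :
  (forall i, i < k -> e i = e' i) -> term_below k t -> eval e t = eval e' t.
Proof.
move=> ee'; elim: t => [i /ee' //|f ts IH] /= /forallP tk.
by congr fi; apply/funext => j; apply: IH.
Qed.

Lemma sat_below k e e' phi :
  (forall i, i < k -> e i = e' i) -> below k phi -> sat e phi = sat e' phi.
Proof.
elim: phi k e e' => //= [t u|p ts|phi IH1 psi IH2|phi IH] k e e' ee'.
- by case/andP=> tk uk; rewrite !(eval_below ee').
- by move=> /forallP tk; congr ri; apply/funext => j; exact: eval_below ee' (tk j).
- by case/andP=> pk qk; rewrite (IH1 k _ e') ?(IH2 k _ e').
- by move=> pk; apply/propext; split=> h x; have := h x;
    rewrite (IH k.+1 _ (sc x e')) // => -[|i] //= /ee'.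
Qed.

Lemma sat_sentence e e' phi : sentence phi -> sat e phi = sat e' phi.
Proof. exact: sat_below. Qed.

Lemma sat_bigAnd (I : finType) e (F : I -> form L) :
  sat e (\big[@And L/Top]_i F i) = forall i, sat e (F i).
Proof.
apply/propext; transitivity (forall i, i \in index_enum I -> sat e (F i)); last first.
  by split=> h i; [apply/h/mem_index_enum|move=> _; apply: h].
elim: index_enum => [|i r IH]; first by rewrite big_nil; split=> [_ i|_].
rewrite big_cons satAnd IH; split=> [[hi hr] j|h].
  by rewrite inE => /predU1P[->|/hr].
by split=> [|j jr]; apply: h; rewrite inE ?eqxx ?jr ?orbT.
Qed.

Lemma sat_bigOr (I : finType) e (F : I -> form L) :
  sat e (\big[@Or L/Fal]_i F i) = exists i, sat e (F i).
Proof.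
apply/propext; transitivity (exists i, i \in index_enum I /\ sat e (F i)); last first.
  by split=> [[i [_ h]]|[i h]]; exists i; rewrite ?mem_index_enum.
elim: index_enum => [|i r IH]; first by rewrite big_nil; split=> //= -[i []].
rewrite big_cons satOr IH; split=> [[h|[j [jr h]]]|[j []]].
- by exists i; rewrite inE eqxx.
- by exists j; rewrite inE jr orbT.
- by rewrite inE => /predU1P[->|jr h]; [left|right; exists j].
Qed.

(** The whole prefix is read as one quantifier over sequences, of which only the first [n] terms
    matter. The outermost quantifier binds the largest index, so the induction fixes that term of
    the sequence first. *)
Lemma sat_alls n e phi :
  sat e (alls n phi) = forall x : nat -> M, sat (fun i => if i < n then x i else e (i - n)) phi.
Proof.
elim: n e => [|n IH] e; apply/propext.
  by split=> [h x|/(_ e)]; rewrite (_ : (fun i => _) = e) //; apply/funext => i; rewrite subn0.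
rewrite /alls iterS -/(alls n phi) /=; split=> [h x|h y]; last first.
  rewrite IH => x; have := h (fun i => if i == n then y else x i).
  congr sat; apply/funext => i; rewrite ltnS; have [ltin|lein|->] := ltngtP i n => //.
    by rewrite -[in RHS](subnSK lein).
  by rewrite subnn.
have := h (x n); rewrite IH => /(_ x); congr sat; apply/funext => i; rewrite ltnS.
by have [ltin|lein|->] := ltngtP i n; rewrite ?subnn // -[in LHS](subnSK lein).
Qed.

Lemma sat_exs n e phi :
  sat e (exs n phi) = exists x : nat -> M, sat (fun i => if i < n then x i else e (i - n)) phi.
Proof.
elim: n e => [|n IH] e; apply/propext.
  split=> [h|[x]]; first exists e;
  by move: h || idtac; rewrite (_ : (fun i => _) = e) //; apply/funext => i; rewrite subn0.
rewrite /exs iterS -/(exs n phi) satEx; split=> [[y]|[x h]].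
  rewrite IH => -[x h]; exists (fun i => if i == n then y else x i).
  move: h; congr sat; apply/funext => i; rewrite ltnS; have [ltin|lein|->] := ltngtP i n => //.
    by rewrite -[in LHS](subnSK lein).
  by rewrite subnn.
exists (x n); rewrite IH; exists x; move: h; congr sat; apply/funext => i; rewrite ltnS.
by have [ltin|lein|->] := ltngtP i n; rewrite ?subnn // -[in RHS](subnSK lein).
Qed.

Lemma soundness (T : set (form L)) phi : prv T phi ->
  forall e, (forall psi, T psi -> sat e psi) -> sat e phi.
Proof.
elim=> {T phi} /=.
- by move=> T phi Tp e; apply.
- by move=> T phi psi _ IH e h hp; apply: IH => chi [/h //|->].
- by move=> T phi psi _ IH1 _ IH2 e h; apply: (IH1 e h); apply: IH2.
- by move=> T phi _ IH e h; apply: contrapT => np; apply: (IH e) => chi [/h //|->].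
- by move=> T phi _ IH e h x; apply: IH => _ [psi /h ? <-]; rewrite sat_shift.
- by move=> T phi t _ IH e h; rewrite sat_inst; apply: IH.
- by [].
- by move=> T phi t u _ IH1 _ IH2 e h; rewrite sat_inst -(IH1 e h) -sat_inst; apply: IH2.
Qed.

End Satisfaction.

(** * Semantics of translations *)

(* A structure in which equality is a relation, functions are given by graphs and
   the elements form a subset of the carrier: this is what a translation defines
   inside a structure, and the terms modulo provable equality are another instance. *)
Record rstruct (L : signature) := RStruct {
  rcar :> Type;
  rdom : rcar -> Prop;
  req : rcar -> rcar -> Prop;
  rfct : forall f : fsym L, ('I_(far f) -> rcar) -> rcar -> Prop;
  rrel : forall r : rsym L, ('I_(rar r) -> rcar) -> Prop }.

Section Quotient.
Variables (L : signature) (X : rstruct L).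
Implicit Types (t : term L) (phi : form L) (e : nat -> X).

(** Follows [tr_term] clause by clause. The value of a variable is its block on the nose, as
    [eq_blocks] compares components; a compound term may have several values, which agree only up to
    [req]. *)
Fixpoint rval e t (y : X) : Prop :=
  match t with
  | Var i => e i = y
  | Fun f ts => exists z : 'I_(far f) -> X,
      [/\ forall j, rdom (z j), forall j, rval e (ts j) (z j) & rfct z y]
  end.

Fixpoint rsat e phi : Prop :=
  match phi with
  | Fal => False
  | Eq t u => exists y z, [/\ rdom y, rdom z, rval e t y, rval e u z & req y z]
  | Rel r ts => exists z : 'I_(rar r) -> X,
      [/\ forall j, rdom (z j), forall j, rval e (ts j) (z j) & rrel z]
  | Imp phi psi => rsat e phi -> rsat e psi
  | All phi => forall x, rdom x -> rsat (sc x e) phi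
  end.

(** What is required to divide by [req] and obtain an ordinary structure. With reflexivity, the
    Euclidean law gives symmetry and transitivity. *)
Record good : Prop := Good {
  good_inh : exists x : X, rdom x;
  good_refl : forall x : X, rdom x -> req x x;
  good_eucl : forall x y z : X, rdom x -> rdom y -> rdom z -> req x y -> req x z -> req y z;
  good_tot : forall f (z : 'I_(far f) -> X), (forall j, rdom (z j)) ->
    exists y, rdom y /\ rfct z y;
  good_fun : forall f (z z' : 'I_(far f) -> X) y y',
    (forall j, rdom (z j)) -> (forall j, rdom (z' j)) -> rdom y -> rdom y' ->
    (forall j, req (z j) (z' j)) -> rfct z y -> rfct z' y' -> req y y';
  good_rel : forall r (z z' : 'I_(rar r) -> X),
    (forall j, rdom (z j)) -> (forall j, rdom (z' j)) ->
    (forall j, req (z j) (z' j)) -> rrel z -> rrel z' }.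

Record quotient (Q : struct L) (q : X -> Q) : Prop := Quotient {
  quo_surj : forall c, exists2 x, rdom x & q x = c;
  quo_eq : forall x y, rdom x -> rdom y -> (q x = q y) = req x y;
  quo_fct : forall f (z : 'I_(far f) -> X) y, (forall j, rdom (z j)) -> rdom y ->
    rfct z y -> fi (fun j => q (z j)) = q y;
  quo_rel : forall r (z : 'I_(rar r) -> X), (forall j, rdom (z j)) ->
    ri (fun j => q (z j)) = rrel z }.

(** The carrier consists of chosen representatives instead of classes: equivalent elements have
    equal classes, and [xget] picks the same element from equal classes. The congruence clauses of
    [good] then carry graphs and relations over to representatives. *)
Lemma quotient_exists : good -> exists Q : struct L, exists q : X -> Q, quotient q.
Proof.
move=> g; have [x0 x0d] := good_inh g.
have symX (x y : X) : rdom x -> rdom y -> req x y -> req y x.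
  by move=> xd yd xy; apply: (good_eucl g xd yd xd xy); apply: good_refl.
pose rep (x : X) : X := @xget {classic X} x0 [set y : X | rdom y /\ req x y].
have repP (x : X) : rdom x -> rdom (rep x) /\ req x (rep x).
  move=> xd; apply: (@xgetPex {classic X} x0 [set y : X | rdom y /\ req x y]).
  by exists x; split=> //; apply: good_refl.
have repE (x y : X) : rdom x -> rdom y -> req x y -> rep x = rep y.
  move=> xd yd xy; congr (@xget {classic X} x0 _); apply/seteqP; split=> z /= [zd h]; split=> //.
    exact: (good_eucl g xd yd zd xy).
  by apply: (good_eucl g yd xd zd _ h); apply: symX.
pose D := {x : X | rdom x /\ rep x = x}.
have repD (x : X) : rdom x -> rdom (rep x) /\ rep (rep x) = rep x.
  move=> xd; have [rd xr] := repP x xd; split=> //.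
  by apply/esym/repE.
(* Outside the domain [q] takes the junk value given by [rep x0]. *)
pose q x : D := match pselect (rdom x) with
  | left xd => exist _ (rep x) (repD x xd)
  | right _ => exist _ (rep x0) (repD x0 x0d) end.
have qE (x : X) : rdom x -> sval (q x) = rep x.
  by rewrite /q; case: pselect.
have Dinj (c c' : D) : sval c = sval c' -> c = c'.
  by case: c c' => [x xp] [y yp] /= xy; subst y; congr exist; apply: Prop_irrelevance.
have qK (c : D) : q (sval c) = c.
  by case: c => x [xd rx]; apply: Dinj; rewrite qE.
have qeq (x y : X) : rdom x -> rdom y -> (q x = q y) = req x y.
  move=> xd yd; apply/propext; split=> [/(congr1 sval)|xy]; last first.
    by apply: Dinj; rewrite !qE //; apply: repE.
  rewrite !qE // => xy; have [rd h] := repP x xd; have [rd' h'] := repP y yd.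
  apply: (good_eucl g rd xd yd); first exact: symX.
  by rewrite xy; apply: symX.
have Dd (c : D) : rdom (sval c) by case: (svalP c).
(* Symbol and arguments are packed into a dependent pair, so that one application of choice provides
   the values of all function symbols. *)
have /choice[F FP] : forall fz : {f : fsym L & 'I_(far f) -> D},
    exists y, rdom y /\ rfct (fun j => sval (tagged fz j)) y.
  by case=> f z; apply: good_tot.
exists (@Struct L D (fun f z => q (F (Tagged _ z)))
  (fun r z => rrel (fun j => sval (z j)))), q.
have qsv (x : X) : rdom x -> req (sval (q x)) x.
  by move=> xd; rewrite -qeq ?qK.
split=> //=.
- by move=> c; exists (sval c).
- move=> f z y zd yd h; have [hd h'] := FP (Tagged _ (fun j => q (z j))).
  rewrite qeq //; apply: (good_fun g _ _ hd yd _ h' h) => // j.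
  exact: qsv.
- move=> r z zd; apply/propext; split; apply: (good_rel g) => // j; first exact: qsv.
  by apply: symX => //; apply: qsv.
Qed.

Variables (Q : struct L) (q : X -> Q).
Hypotheses (gX : good) (qX : quotient q).

Lemma rval_quotient e t y : (forall i, rdom (e i)) -> rdom y -> rval e t y ->
  eval (fun i => q (e i)) t = q y.
Proof.
move=> ed; elim: t y => [i|f ts IH] y yd /= => [-> //|[z [zd h zy]]].
by rewrite -(quo_fct qX zd yd zy); congr fi; apply/funext => j; apply: IH.
Qed.

Lemma rval_exists e t : (forall i, rdom (e i)) -> exists y, rdom y /\ rval e t y.
Proof.
move=> ed; elim: t => [i|f ts /choice[z zP]] /=; first by exists (e i).
have [|y [yd zy]] := @good_tot gX f z; first by move=> j; case: (zP j).
by exists y; split=> //; exists z; split=> // j; case: (zP j).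
Qed.

(** Surjectivity of [q] matches the quantifiers. In an atom, each term has a value by totality and
    all its values have the same image under [q], so unravelling the atom does not change its
    meaning. *)
Lemma rsat_quotient e phi : (forall i, rdom (e i)) ->
  rsat e phi = sat (fun i => q (e i)) phi.
Proof.
elim: phi e => //= [t u|r ts|phi IH1 psi IH2|phi IH] e ed; first 2 last.
- by rewrite IH1 // IH2.
- have ed' x : rdom x -> forall i, rdom (sc x e i) by move=> xd [].
  have qe x : (fun i => q (sc x e i)) = sc (q x) (fun i => q (e i)).
    by apply/funext => -[].
  apply/propext; split=> h x => [|xd].
    by have [y yd <-] := quo_surj qX x; rewrite -qe -IH; auto.
  by rewrite IH ?qe; auto.
- apply/propext; split=> [[y [z [yd zd hy hz]]]|].
    by rewrite (rval_quotient ed yd hy) (rval_quotient ed zd hz) (quo_eq qX).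
  have [y [yd hy]] := rval_exists t ed; have [z [zd hz]] := rval_exists u ed.
  rewrite (rval_quotient ed yd hy) (rval_quotient ed zd hz) (quo_eq qX) // => yz.
  by exists y, z.
- apply/propext; split=> [[z [zd h]]|].
    rewrite -(quo_rel qX zd); congr ri; apply/funext => j.
    by rewrite (rval_quotient ed _ (h j)).
  have /choice[z zP] := fun j => rval_exists (ts j) ed.
  move=> h; exists z; split=> [j|j|]; try by case: (zP j).
  rewrite -(quo_rel qX); last by move=> j; case: (zP j).
  move: h; congr ri; apply/funext => j; case: (zP j) => zd zj.
  by rewrite (rval_quotient ed zd zj).
Qed.

End Quotient.

(** * Enumeration of formulas and Henkin's completeness theorem *)

Section Countability.
Variable L : signature.

(** Trees are countable and make injectivity a structural induction, whereas words in Polish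
    notation would call for unique readability. *)
Fixpoint term_tree (t : term L) : GenTree.tree nat :=
  match t with
  | Var i => GenTree.Leaf i
  | Fun f ts => GenTree.Node (pickle f) [seq term_tree (ts j) | j <- enum 'I_(far f)]
  end.

Fixpoint form_tree (phi : form L) : GenTree.tree nat :=
  match phi with
  | Fal => GenTree.Node 0 [::]
  | Eq t u => GenTree.Node 1 [:: term_tree t; term_tree u]
  | Imp phi psi => GenTree.Node 2 [:: form_tree phi; form_tree psi]
  | All phi => GenTree.Node 3 [:: form_tree phi]
  | Rel r ts => GenTree.Node (4 + pickle r) [seq term_tree (ts j) | j <- enum 'I_(rar r)]
  end.

Lemma term_tree_inj : injective term_tree.
Proof.
elim=> [i|f ts IH] [k|f' us] //= []; first by move=> ->.
move=> /(pcan_inj pickleK) ff'; case: f' / ff' us => us /eq_in_map h.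
by congr Fun; apply/funext => j; apply/IH/h; rewrite mem_enum.
Qed.

Lemma form_tree_inj : injective form_tree.
Proof.
elim=> [|t u|r ts|phi IH1 psi IH2|phi IH] [|t' u'|r' us|phi' psi'|phi'] //=; case.
- by move=> /term_tree_inj -> /term_tree_inj ->.
- move=> /(pcan_inj pickleK) rr'; case: r' / rr' us => us /eq_in_map h.
  by congr Rel; apply/funext => j; apply/term_tree_inj/h; rewrite mem_enum.
- by move=> /IH1 -> /IH2 ->.
- by move=> /IH ->.
Qed.

Lemma form_enumeration : exists enumf : nat -> form L, forall phi, exists n, enumf n = phi.
Proof.
have /choice[enumf enumfP] n :
    exists phi, forall psi, pickle (form_tree psi) = n -> psi = phi.
  have [[phi h]|h] := EM (exists phi, pickle (form_tree phi) = n).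
    by exists phi => psi; rewrite -h => /(pcan_inj pickleK)/form_tree_inj.
  (* A number that codes no formula is sent to [Fal]. *)
  by exists Fal => psi hpsi; case: h; exists psi.
by exists enumf => phi; exists (pickle (form_tree phi)); apply/esym/enumfP.
Qed.

End Countability.

Section Completeness.
Variable L : signature.
Implicit Types (T S : set (form L)) (t u : term L) (phi psi : form L).

(** The default [x] sits in particular at index n, exactly where the graph of an n-ary symbol
    expects its value. *)
Definition extend (T : Type) n (z : 'I_n -> T) (x : T) (i : nat) : T :=
  if insub i is Some j then z j else x.

Lemma extend_ord (T : Type) n (z : 'I_n -> T) x (j : 'I_n) : extend z x j = z j.
Proof. by rewrite /extend valK. Qed.

Lemma extend_lt (T : Type) n (z : 'I_n -> T) x i (ltin : i < n) :
  extend z x i = z (Ordinal ltin).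
Proof. exact: (extend_ord z x (Ordinal ltin)). Qed.

Lemma extendE (T : Type) n (z : 'I_n -> T) x : (fun j : 'I_n => extend z x j) = z.
Proof. by apply/funext => j; apply: extend_ord. Qed.

Lemma extend_out (T : Type) n (z : 'I_n -> T) x : extend z x n = x.
Proof. by rewrite /extend insubF // ltnn. Qed.

(** The rule [prv_eqE] replaces a single term, so the two substitutions are exchanged one variable
    at a time, through the mixtures [mix m]. *)
Lemma prv_subst_eq T k phi (s s' : nat -> term L) :
  below k phi -> (forall i, i < k -> prv T (Eq (s i) (s' i))) ->
  prv T (subst s phi) -> prv T (subst s' phi).
Proof.
move=> pk ss' h.
pose mix m i := if i < m then s' i else s i.
suff mixP m : m <= k -> prv T (subst (mix m) phi).
  rewrite (@subst_below _ k _ (mix k)) //; first exact: mixP.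
  by move=> i; rewrite /mix => ->.
elim: m => [_|m IH mk].
  by rewrite (@subst_below _ k _ s).
(* [r] keeps a hole, [Var 0], at place [m] only; filling it with [s m] or with [s' m] gives two
   consecutive mixtures. *)
pose r i := if i < m then shift (s' i) else if i == m then Var 0 else shift (s i).
have rE t i : subst_term (scons t Var) (r i) = if i < m then s' i else if i == m then t else s i.
  rewrite /r; case: ltnP => _; first by rewrite /shift subst_term_comp subst_term_id.
  by case: eqP => // _; rewrite /shift subst_term_comp subst_term_id.
have -> : subst (mix m.+1) phi = inst (subst r phi) (s' m).
  rewrite /inst subst_comp; congr subst; apply/funext => i; rewrite rE /mix ltnS.
  by case: ltngtP => // ->.
apply: (prv_eqE (ss' m mk)).
suff -> : inst (subst r phi) (s m) = subst (mix m) phi by apply/IH/ltnW.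
rewrite /inst subst_comp; congr subst; apply/funext => i; rewrite rE /mix.
by case: ltngtP => // ->.
Qed.

Definition consistent T := ~ prv T Fal.

(** The term model before division by provable equality; its quotient is the model used for
    completeness. *)
Definition term_rstruct T : rstruct L :=
  @RStruct L (term L) (fun=> True) (fun t u => prv T (Eq t u))
    (fun f z y => prv T (Eq (@Fun L f z) y)) (fun r z => prv T (@Rel L r z)).

Lemma prv_eucl T t u v : prv T (Eq t u) -> prv T (Eq t v) -> prv T (Eq u v).
Proof.
move=> tu; apply: (@prv_subst_eq T 2 (Eq (Var 0) (Var 1))
  (scons t (fun=> v)) (scons u (fun=> v))) => //.
by case=> [|[|]] //= _; apply: prv_eqI.
Qed.

Lemma term_rstruct_good T : good (term_rstruct T).
Proof.
split=> //=.
- by exists (Var 0).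
- by move=> t _; apply: prv_eqI.
- by move=> t u v _ _ _; apply: prv_eucl.
- by move=> f z _; exists (Fun z); split=> //; apply: prv_eqI.
- move=> f z z' y y' _ _ _ _ zz' zy z'y'.
  apply: prv_eucl z'y'.
  have := @prv_subst_eq T (far f).+1 (Eq (@Fun L f (fun j => Var j)) (Var (far f)))
    (extend z y) (extend z' y).
  rewrite /= !extend_out !extendE.
  apply=> //.
  + by rewrite ltnS leqnn andbT; apply/forallP => j; rewrite ltnS ltnW.
  + move=> i; rewrite ltnS leq_eqVlt => /predU1P[->|ilt].
      by rewrite !extend_out; apply: prv_eqI.
    by rewrite -[i]/(val (Ordinal ilt)) !extend_ord.
- move=> r z z' _ _ zz'.
  have := @prv_subst_eq T (rar r) (@Rel L r (fun j => Var j))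
    (extend z (Var 0)) (extend z' (Var 0)).
  rewrite /= !extendE.
  apply=> //.
  + by apply/forallP => j.
  + by move=> i ilt; rewrite -[i]/(val (Ordinal ilt)) !extend_ord.
Qed.

(** Variables play the part of Henkin constants, so the language never grows. For a fresh one to
    exist at each step, a bound on the free variables of the theory is kept as part of the
    invariant. *)
Lemma henkin_step S phi : consistent S -> (exists k, forall psi, S psi -> below k psi) ->
  exists S', [/\ consistent S', exists k, forall psi, S' psi -> below k psi, S `<=` S',
    S' phi \/ ~ consistent (S `|` [set phi])
    & forall psi, S' phi -> phi = Not (All psi) -> exists t, S' (Not (inst psi t))].
Proof.
move=> Sc [k Sk].
have [c|nc] := EM (consistent (S `|` [set phi])); last first.
  exists S; split=> //; [by exists k|by right|].
  move=> psi Sphi _; case: nc; suff -> : S `|` [set phi] = S by [].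
  by apply/setUidPl => _ ->.
have [m pm] := below_ex phi.
have Sm psi : (S `|` [set phi]) psi -> below (maxn k m) psi.
  by move=> [/Sk|->]; [apply: below_le|apply: below_le pm]; rewrite ?leq_maxl ?leq_maxr.
have [[psi phiE]|h] := EM (exists psi, phi = Not (All psi)); last first.
  exists (S `|` [set phi]); split=> //; [by exists (maxn k m)|by left; right|].
  by move=> psi _ phiE; case: h; exists psi.
set M := maxn k m in Sm.
have psiM : below M.+1 psi by have /= := Sm phi (or_intror erefl); rewrite phiE /= andbT.
pose w := Not (inst psi (Var M)).
exists (S `|` [set phi] `|` [set w]); split=> //.
(* If adding the witness were inconsistent, [psi] would be provable of the fresh variable, hence
   [All psi] would be provable, against [phi]. *)
- move=> /prv_raa /(prv_gen Sm psiM) h; apply: c.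
  by apply: prv_impE h; rewrite phiE; apply: prv_last.
- exists M.+1 => chi [/Sm|->]; first by apply: below_le.
  rewrite /= andbT; apply: below_subst psiM => -[|i] /= iM; first exact: ltnSn.
  by apply: ltnW.
- by move=> chi Schi; left; left.
- by left; left; right.
- by move=> psi' _; rewrite phiE => -[<-]; exists (Var M); right.
Qed.

(** The construction can start because [T] consists of sentences, so that [T] with [Not phi] has
    bounded free variables. The formulas are decided along the enumeration, and the limit is
    consistent by compactness. *)
Lemma henkin_extension T phi : T `<=` @sentence L -> ~ prv T phi ->
  exists G, [/\ T `<=` G, prv G (Not phi), consistent G,
    forall psi, prv G psi \/ prv G (Not psi)
    & forall psi, prv G (Not (All psi)) -> exists t, prv G (Not (inst psi t))].
Proof.
move=> Tsent nT; have [enumf enumfP] := form_enumeration L.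
pose state := {S | consistent S /\ exists k, forall psi, S psi -> below k psi}.
have S0P : consistent (T `|` [set Not phi]) /\
    exists k, forall psi, (T `|` [set Not phi]) psi -> below k psi.
  split=> [/prv_raa//|]; have [k phik] := below_ex phi.
  by exists k => psi [/Tsent|->] /=; [apply: below_le|rewrite phik].
have /choice[step stepP] : forall sp : state * form L, exists s' : state,
    [/\ sval sp.1 `<=` sval s',
       sval s' sp.2 \/ ~ consistent (sval sp.1 `|` [set sp.2])
     & forall psi, sval s' sp.2 -> sp.2 = Not (All psi) -> exists t, sval s' (Not (inst psi t))].
  move=> [[S [Sc Sk]] psi] /=; have [S' [c' k' SS' h1 h2]] := henkin_step psi Sc Sk.
  by exists (exist _ S' (conj c' k')).
pose st := fix st n : state := if n is m.+1 then step (st m, enumf m) else exist _ _ S0P.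
pose G := \bigcup_n sval (st n).
have stS n : sval (st n) `<=` sval (st n.+1) by have [] := stepP (st n, enumf n).
have stm m n : m <= n -> sval (st m) `<=` sval (st n).
  by move=> /subnK <-; elim: (n - m) => // i IH psi /IH /stS.
have Gc : consistent G.
  move=> /prv_chain /(_ (fun n => sval (st n)) stm)[psi [n _]|n].
    by exists n.
  by have [] := svalP (st n).
have Gn n : sval (st n) `<=` G by move=> psi h; exists n.
have Gmax psi : G psi \/ prv G (Not psi).
  have [n <-] := enumfP psi; have [_ [h|h] _] := stepP (st n, enumf n).
    by left; apply: (Gn n.+1).
  right; apply: prv_impI; move: h => /contrapT; apply: prv_weak.
  exact/setSU/Gn.
exists G; split=> //.
- by move=> psi Tpsi; apply: (Gn 0); left.
- by apply: prv_ax; apply: (Gn 0); right.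
- by move=> psi; have [h|h] := Gmax psi; [left; apply: prv_ax|right].
move=> psi h; have [n nE] := enumfP (Not (All psi)).
have [_ h1 h2] := stepP (st n, enumf n); rewrite /= nE in h1 h2.
case: h1 => [h1|/contrapT h1]; last first.
  by case: Gc; apply: prv_cut h _; apply: prv_weak h1; apply/setSU/Gn.
have [t ht] := h2 _ h1 erefl; exists t; apply: prv_ax; apply: (Gn n.+1) => /=.
by rewrite nE.
Qed.

Theorem completeness T phi : T `<=` @sentence L ->
  (forall (M : struct L) (e : nat -> M), (forall psi, T psi -> sat e psi) -> sat e phi) ->
  prv T phi.
Proof.
move=> Tsent valid; apply: contrapT => /(henkin_extension Tsent)[G [TG Gphi Gc Gmax Gwit]].
have gG := term_rstruct_good G; have [Q [q qQ]] := quotient_exists gG.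
have evalE (s : nat -> term L) t : eval (fun i => q (s i)) t = q (subst_term s t).
  elim: t => //= f ts IH; rewrite -(quo_fct qQ (z := fun j => subst_term s (ts j))) //=.
    by congr fi; apply/funext.
  exact: prv_eqI.
(* The truth lemma is stated for all substitutions at once, since going under a quantifier replaces
   the environment by one that lifts to another sequence of terms. *)
have satE psi : forall s : nat -> term L, sat (fun i => q (s i)) psi = prv G (subst s psi).
  elim: psi => /= [|t u|r ts|psi1 IH1 psi2 IH2|psi IH] s.
  - by apply/propext; split.
  - by rewrite !evalE (quo_eq qQ).
  - rewrite -[RHS](quo_rel qQ (z := fun j => subst_term s (ts j))) //.
    by congr ri; apply/funext => j; rewrite evalE.
  - rewrite IH1 IH2; apply/propext; split=> [h|]; last exact: prv_impE.
    have [/h h2|h1] := Gmax (subst s psi1).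
      by apply/prv_impI/prv_weak/h2/subsetUl.
    apply: prv_impI; apply: prv_Fal; apply: prv_impE (prv_last _ _).
    by apply: prv_weak h1; apply: subsetUl.
  - have scE t : sc (q t) (fun i => q (s i)) = fun i => q (scons t s i).
      by apply/funext => -[].
    apply/propext; split=> [h|h c]; last first.
      by have [t _ <-] := quo_surj qQ c; rewrite scE IH -inst_up; apply: prv_allE.
    (* An unprovable universal formula has a refuted instance by the Henkin property, against [h] at
       the class of that term. *)
    have [//|/Gwit[t ht]] := Gmax (All (subst (up s) psi)).
    case: Gc; apply: prv_impE ht _; rewrite inst_up -IH -scE; exact: h.
have := valid Q (fun i => q (Var i)); rewrite satE subst_id.
have ax psi : T psi -> sat (fun i => q (Var i)) psi.
  by move=> /TG Gpsi; rewrite satE subst_id; apply: prv_ax.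
by move=> /(_ ax) h; apply: Gc; apply: prv_impE Gphi h.
Qed.

End Completeness.

Section RelationalSatisfaction.
Variables (L : signature) (X : rstruct L).
Implicit Types (t : term L) (phi psi : form L) (e : nat -> X).

Lemma rsatAnd e phi psi : rsat e (And phi psi) = (rsat e phi /\ rsat e psi).
Proof.
by apply/propext => /=; have [] := EM (rsat e phi); have [] := EM (rsat e psi); tauto.
Qed.

Lemma rsatEx e phi : rsat e (Ex phi) = exists x, rdom x /\ rsat (sc x e) phi.
Proof.
apply/propext => /=; split=> [h|[x [xd h]] /(_ x xd)]; last by apply.
by apply: contrapT => h'; apply: h => x xd hx; apply: h'; exists x.
Qed.

Lemma rsat_bigAnd (I : finType) e (F : I -> form L) :
  (forall i, rsat e (F i)) -> rsat e (\big[@And L/Top]_i F i).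
Proof.
by move=> h; apply: big_ind => [//|phi psi hp hq|i _]; [rewrite rsatAnd|apply: h].
Qed.

Lemma rsat_alls n e phi : rsat e (alls n phi) = forall x : nat -> X,
  (forall i, i < n -> rdom (x i)) -> rsat (fun i => if i < n then x i else e (i - n)) phi.
Proof.
elim: n e => [|n IH] e; apply/propext.
  by split=> [h x _|/(_ e)]; rewrite (_ : (fun i => _) = e) => [|] //;
    [apply/funext => i; rewrite subn0|apply|apply/funext => i; rewrite subn0].
rewrite /alls iterS -/(alls n phi) /=; split=> [h x xd|h y yd]; last first.
  rewrite IH => x xd; have := h (fun i => if i == n then y else x i).
  have -> : (fun i => if i < n.+1 then if i == n then y else x i else e (i - n.+1)) =
      (fun i => if i < n then x i else sc y e (i - n)).
    apply/funext => i; rewrite ltnS; have [ltin|lein|->] := ltngtP i n => //.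
      by rewrite -[in RHS](subnSK lein).
    by rewrite subnn.
  by apply=> i; rewrite ltnS leq_eqVlt; case: eqP => // _ /=; apply: xd.
have := h (x n) (xd n (ltnSn n)); rewrite IH => /(_ x (fun i ltin => xd i (ltnW ltin))).
congr rsat; apply/funext => i; rewrite ltnS.
by have [ltin|lein|->] := ltngtP i n; rewrite ?subnn // -[in LHS](subnSK lein).
Qed.

Lemma rval_below k e e' t y :
  (forall i, i < k -> e i = e' i) -> term_below k t -> rval e t y = rval e' t y.
Proof.
move=> ee'; elim: t y => [i|f ts IH] y /=; first by move=> /ee' ->.
move=> /forallP tk; apply/propext; split=> -[z [zd h zy]]; exists z; split=> // j;
  by have := h j; rewrite IH.
Qed.

Lemma rsat_below k e e' phi :
  (forall i, i < k -> e i = e' i) -> below k phi -> rsat e phi = rsat e' phi.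
Proof.
elim: phi k e e' => //= [t u|p ts|phi IH1 psi IH2|phi IH] k e e' ee'.
- case/andP=> tk uk; apply/propext; split=> -[y [z [yd zd hy hz yz]]]; exists y, z;
    split=> //; move: hy hz; by rewrite !(rval_below _ ee').
- move=> /forallP tk; apply/propext; split=> -[z [zd h zr]]; exists z;
    split=> // j; have := h j; by rewrite (rval_below _ ee').
- by case/andP=> pk qk; rewrite (IH1 k _ e') ?(IH2 k _ e').
- by move=> pk; apply/propext; split=> h x xd; have := h x xd;
    rewrite (IH k.+1 _ (sc x e')) // => -[|i] //= /ee'.
Qed.

End RelationalSatisfaction.

(** * The relational structure defined by a translation inside a model *)

Section TranslationSemantics.
Variables (L K : signature) (tau : translation L K) (M : struct K).
Local Notation d := (dim tau).
Hypothesis wf : translation_wf tau.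
Local Notation block := ('I_d -> M).
Implicit Types (B : nat -> block) (phi : form K).

Lemma dim_gt0 : 0 < d. Proof. by case: wf. Qed.

Definition flat B (v : nat) : M := B (v %/ d) (Ordinal (ltn_pmod v dim_gt0)).
Definition blocks (e : nat -> M) (b : nat) : block := fun c => e (b * d + c).

Lemma blocksK e : flat (blocks e) = e.
Proof. by apply/funext => v; rewrite /flat /blocks /= -divn_eq. Qed.

Lemma flatE B b (c : 'I_d) : flat B (b * d + c) = B b c.
Proof.
rewrite /flat; set c' := Ordinal _; rewrite (_ : c' = c).
  by rewrite divnMDl ?dim_gt0 // divn_small // addn0.
by apply/val_inj; rewrite /= modnMDl modn_small.
Qed.

Lemma flat_below B B' n v :
  (forall b, b < n -> B b = B' b) -> v < n * d -> flat B v = flat B' v.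
Proof. by move=> BB' vn; rewrite /flat BB' // ltn_divLR // dim_gt0. Qed.

(** Sequences of blocks are infinite, so the positions after the arguments are filled up: with the
    last argument for [dom] and [eqn], with the value for graphs, with [x0] for relations. The
    bounds in [translation_wf] make the filler irrelevant. *)
Definition tr_rstruct (x0 : M) : rstruct L :=
  @RStruct L block
    (fun x => sat (flat (fun=> x)) (dom tau))
    (fun x y => sat (flat (sc x (fun=> y))) (eqn tau))
    (fun f z y => sat (flat (extend z y)) (fct tau f))
    (fun r z => sat (flat (extend z (fun=> x0))) (rel tau r)).

Variable x0 : M.
Local Notation X := (tr_rstruct x0).

Lemma sat_rename_blocks B a phi :
  sat (flat B) (rename_blocks tau a phi) = sat (flat (fun b => B (a b))) phi.
Proof.
rewrite /rename_blocks sat_rename; congr sat; apply/funext => v.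
by rewrite -[v %% d]/(val (Ordinal (ltn_pmod v dim_gt0))) flatE.
Qed.

Lemma sat_alls_blocks n B phi : sat (flat B) (alls (n * d) phi) =
  forall z : nat -> block, sat (flat (fun b => if b < n then z b else B (b - n))) phi.
Proof.
have env (z : nat -> block) :
    flat (fun b => if b < n then z b else B (b - n)) =
    fun i => if i < n * d then flat z i else flat B (i - n * d).
  apply/funext => v; rewrite /flat; rewrite -ltn_divLR ?dim_gt0 //; case: ltnP => // nv.
  have nv' : n * d <= v by rewrite -leq_divRL ?dim_gt0.
  rewrite -[in LHS](subnK nv') addnC divnMDl ?dim_gt0 // addKn.
  by congr (B _ _); apply/val_inj; rewrite /= modnMDl.
rewrite sat_alls; apply/propext; split=> h z; first by rewrite env; apply: h.
by have := h (blocks z); rewrite env blocksK.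
Qed.

Lemma sat_exs_blocks n B phi : sat (flat B) (exs (n * d) phi) =
  exists z : nat -> block, sat (flat (fun b => if b < n then z b else B (b - n))) phi.
Proof.
have -> : sat (flat B) (exs (n * d) phi) = ~ sat (flat B) (alls (n * d) (Not phi)).
  rewrite sat_exs sat_alls; apply/propext; split=> [[x h] /(_ x)|h]; first by apply.
  by apply: contrapT => h'; apply: h => x hx; apply: h'; exists x.
rewrite sat_alls_blocks; apply/propext; split=> [h|[z h] /(_ z)]; last by apply.
by apply: contrapT => h'; apply: h => z hz; apply: h'; exists z.
Qed.

Lemma sat_ex_blocks n B phi : sat (flat B) (ex_blocks tau n phi) =
  exists z : 'I_n -> block, (forall j, rdom (z j : X)) /\
    sat (flat (fun b => if insub b is Some j then z j else B (b - n))) phi.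
Proof.
rewrite /ex_blocks sat_exs_blocks.
have envE : forall z : nat -> block, (fun b => if b < n then z b else B (b - n)) =
    (fun b => if @insub _ (fun i => i < n) 'I_n b is Some j then z j else B (b - n)).
  move=> z; apply/funext => b; case: insubP => [j -> <- //|].
  by rewrite -leqNgt => h; rewrite ltnNge h.
apply/propext; split=> [[z]|[z [zd h]]].
  rewrite envE satAnd sat_bigAnd => -[zd h]; exists (fun j => z j); split=> // j.
  by have := zd j; rewrite sat_rename_blocks valK.
exists (extend z (fun=> x0)); rewrite envE satAnd sat_bigAnd; split=> [j|].
  by rewrite sat_rename_blocks valK extend_ord; apply: zd.
move: h; congr sat; congr flat; apply/funext => b.
by case: insubP => // j _ _; rewrite extend_ord.
Qed.

Lemma sat_eq_blocks B i j : sat (flat B) (eq_blocks tau i j) = (B i = B j).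
Proof.
rewrite /eq_blocks sat_bigAnd; apply/propext; split=> [h|BB c] /=; last first.
  by rewrite !flatE BB.
by apply/funext => c; have := h c; rewrite /= !flatE.
Qed.

Lemma sat_tr_term B k t y :
  sat (flat B) (tr_term tau k t y) = rval (fun i => B (i + k) : X) t (B y).
Proof.
elim: t B k y => [i|f ts IH] B k y /=; first by rewrite sat_eq_blocks.
rewrite sat_ex_blocks.
have shiftE (z : 'I_(far f) -> block) i :
    (if @insub _ (fun i => i < far f) 'I_(far f) (i + far f) is Some j then z j
    else B (i + far f - far f)) = B i.
  by rewrite insubF ?addnK // ltnNge leq_addl.
apply/propext; split=> [[z]|[z [zd h hf]]].
  rewrite !satAnd sat_bigAnd sat_rename_blocks => -[zd [h hf]]; exists z; split=> // [j|].
    have := h j; rewrite IH valK; congr rval; apply/funext => i.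
    by rewrite addnA shiftE.
  move: hf; rewrite /=; congr sat; congr flat; apply/funext => b; rewrite /extend.
  case: ltnP => [bf|fb]; last by rewrite shiftE insubF // ltnNge fb.
  by rewrite insubT.
exists z; rewrite satAnd sat_bigAnd sat_rename_blocks.
split=> //; split=> [j|].
  have := h j; rewrite IH valK; congr rval; apply/funext => i.
  by rewrite addnA shiftE.
move: hf; rewrite /=; congr sat; congr flat; apply/funext => b; rewrite /extend.
case: ltnP => [bf|fb]; last by rewrite shiftE insubF // ltnNge fb.
by rewrite insubT.
Qed.

(** The clauses of [rsat] imitate those of [tr], so what remains is the bookkeeping of blocks: [n]
    new blocks come first, and the old block i becomes block i + n. *)
Lemma sat_tr B (phi : form L) : sat (flat B) (tr tau phi) = rsat (B : nat -> X) phi.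
Proof.
have [_ _ eqn_below _ rel_below] := wf.
have shiftE n (z : 'I_n -> block) (B' : nat -> block) :
    (fun i => if @insub _ (fun i => i < n) 'I_n (i + n) is Some j then z j
      else B' (i + n - n)) = B'.
  by apply/funext => i; rewrite insubF ?addnK // ltnNge leq_addl.
elim: phi B => //= [t u|r ts|phi IH1 psi IH2|phi IH] B.
- have eqnE (B' : nat -> block) :
      sat (flat B') (eqn tau) = req (B' 0 : X) (B' 1).
    by apply: sat_below eqn_below => v; apply: flat_below => -[|[|]].
  rewrite sat_ex_blocks; apply/propext; split=> [[z]|[y [z [yd zd hy hz yz]]]].
    rewrite !satAnd !sat_tr_term !shiftE eqnE.
    rewrite -[0]/(val (@Ordinal 2 0 isT)) -[1]/(val (@Ordinal 2 1 isT)) !valK.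
    move=> [zd [[hy hz] yz]].
    by exists (z (@Ordinal 2 0 isT)), (z (@Ordinal 2 1 isT)); split=> //; apply: zd.
  exists (fun j => if val j == 0 then y else z); split=> [j|]; first by case: eqP.
  rewrite !satAnd !sat_tr_term !shiftE eqnE.
  by rewrite -[0]/(val (@Ordinal 2 0 isT)) -[1]/(val (@Ordinal 2 1 isT)) !valK.
- have relE z : sat (flat (fun b => if insub b is Some j then z j else B (b - rar r))) (rel tau r)
      = rrel (z : 'I_(rar r) -> X).
    apply: sat_below (rel_below r) => v; apply: flat_below => b br.
    by rewrite /extend insubT.
  rewrite sat_ex_blocks; apply/propext; split=> [[z]|[z [zd h hr]]].
    rewrite satAnd sat_bigAnd relE => -[zd [h hr]]; exists z; split=> // j.
    by have := h j; rewrite sat_tr_term shiftE valK.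
  exists z; rewrite satAnd sat_bigAnd relE; split=> //; split=> // j.
  by rewrite sat_tr_term shiftE valK.
- by rewrite IH1 // IH2.
- have -> : alls d (Imp (dom tau) (tr tau phi)) = alls (1 * d) (Imp (dom tau) (tr tau phi)).
    by rewrite mul1n.
  rewrite sat_alls_blocks; apply/propext.
  have scE (z : nat -> block) :
      (fun b => if b < 1 then z b else B (b - 1)) = sc (z 0 : X) B.
    by apply/funext => -[|b] //=; rewrite subn1.
  have domE (z : nat -> block) : sat (flat (sc (z 0 : X) B)) (dom tau) = rdom (z 0 : X).
    have [_ dom_below _ _ _] := wf; apply: sat_below dom_below => v.
    by rewrite -[X in _ < X]mul1n; apply: flat_below => -[].
  split=> [h x|h z]; last by rewrite scE /= domE IH; apply: h.
  by have := h (fun=> x); rewrite scE /= domE IH.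
Qed.

End TranslationSemantics.

Section Below.
Variable L : signature.
Implicit Types (phi psi : form L).

Lemma below_alls k n phi : below k (alls n phi) = below (n + k) phi.
Proof. by elim: n k => //= n IH k; rewrite IH addSnnS. Qed.

Lemma below_exs k n phi : below k (exs n phi) = below (n + k) phi.
Proof. by elim: n k => //= n IH k; rewrite !andbT IH addSnnS. Qed.

Lemma below_And k phi psi : below k phi -> below k psi -> below k (And phi psi).
Proof. by move=> /= -> ->. Qed.

Lemma below_bigAnd k (I : finType) (F : I -> form L) :
  (forall i, below k (F i)) -> below k (\big[@And L/Top]_i F i).
Proof. by move=> h; apply: (big_ind (fun phi => below k phi)) => [|phi psi|i _] //= -> ->. Qed.

Lemma below_bigOr k (I : finType) (F : I -> form L) :
  (forall i, below k (F i)) -> below k (\big[@Or L/Fal]_i F i).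
Proof. by move=> h; apply: (big_ind (fun phi => below k phi)) => [|phi psi|i _] //= -> ->. Qed.

End Below.

Section TranslationBelow.
Variables (L K : signature) (tau : translation L K).
Local Notation d := (dim tau).
Hypothesis wf : translation_wf tau.

Lemma below_rename_blocks a n k (phi : form K) :
  (forall b, b < n -> a b < k) -> below (n * d) phi -> below (k * d) (rename_blocks tau a phi).
Proof.
move=> ak; apply: below_subst => v vn /=; have d0 := dim_gt0 wf.
apply: (@leq_trans ((a (v %/ d)).+1 * d)); first by rewrite mulSn addnC ltn_add2r ltn_pmod.
by rewrite leq_mul2r ak ?orbT // ltn_divLR.
Qed.

Lemma below_eq_blocks i j k : i < k -> j < k -> below (k * d) (eq_blocks tau i j).
Proof.
have lt b (c : 'I_d) : b < k -> b * d + c < k * d.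
  move=> bk; apply: (@leq_trans (b.+1 * d)); first by rewrite mulSn addnC ltn_add2r.
  by rewrite leq_mul2r bk orbT.
by move=> ik jk; apply: below_bigAnd => c /=; rewrite !lt.
Qed.

Lemma below_ex_blocks n k (phi : form K) :
  below ((n + k) * d) phi -> below (k * d) (ex_blocks tau n phi).
Proof.
move=> h; rewrite /ex_blocks below_exs -mulnDl /= h !andbT.
apply: below_bigAnd => j; apply: (@below_rename_blocks _ 1); last by rewrite mul1n; case: wf.
by move=> b _; exact: (leq_trans (ltn_ord j) (leq_addr _ _)).
Qed.

Lemma below_tr_term m k t y : term_below m t -> y < m + k ->
  below ((m + k) * d) (tr_term tau k t y).
Proof.
elim: t k y => [i|f ts IH] k y /=.
  by move=> im ym; apply: below_eq_blocks; rewrite ?ltn_add2r.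
move=> /forallP tm ym; apply: below_ex_blocks; rewrite /= !andbT; apply/andP; split.
  apply: below_bigAnd => j; rewrite addnCA [far f + k]addnC; apply: IH => //.
  by rewrite addnA; exact: (leq_trans (ltn_ord j) (leq_addl _ _)).
apply: (@below_rename_blocks _ (far f).+1); last by case: wf.
move=> b _; case: (ltnP b (far f)) => [bf|_]; first exact: (leq_trans bf (leq_addr _ _)).
by rewrite addnC ltn_add2l.
Qed.

Lemma below_tr k phi : below k phi -> below (k * d) (tr tau phi).
Proof.
have [_ dom_b eqn_b _ rel_b] := wf.
elim: phi k => //= [t u|r ts|phi IH1 psi IH2|phi IH] k.
- case/andP=> tk uk; apply: below_ex_blocks; rewrite /= !andbT.
  rewrite [2 + k]addnC !below_tr_term //=; try by rewrite addnC.
  by apply: below_le eqn_b; rewrite leq_mul2r leq_addl orbT.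
- move=> /forallP tk; apply: below_ex_blocks; rewrite /= !andbT; apply/andP; split.
    apply: below_bigAnd => j; rewrite addnC; apply: below_tr_term => //.
    by exact: (leq_trans (ltn_ord j) (leq_addl _ _)).
  by apply: below_le (rel_b r); rewrite leq_mul2r leq_addr orbT.
- by case/andP=> *; rewrite IH1 ?IH2.
- move=> pk; rewrite below_alls -mulSn /= IH // andbT.
  by apply: below_le dom_b; rewrite mulSn leq_addr.
Qed.

End TranslationBelow.

(** * Interpretations seen through models *)

Definition models (L : signature) (M : struct L) (U : set (form L)) : Prop :=
  forall psi, U psi -> forall e : nat -> M, sat e psi.

Lemma valid_prv (L : signature) (V : set (form L)) phi :
  (forall (M : struct L) (e : nat -> M), sat e phi) -> prv V phi.
Proof.
move=> h; apply: (@prv_weak _ set0); first exact: sub0set.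
by apply: completeness => [psi []|M e _].
Qed.

Section Interpretation.
Variables (L K : signature) (tau : translation L K) (V : set (form L)) (U : set (form K)).

(** Soundness in the quotient followed by completeness for [U] reduces the construction of an
    interpretation to a construction inside each model. *)
Lemma interpretation_intro : U `<=` @sentence K -> forall wf : translation_wf tau,
  (forall (M : struct K) (x0 : M), models M U ->
     good (tr_rstruct wf x0) /\
     exists (Q : struct L) (q : tr_rstruct wf x0 -> Q), quotient q /\ models Q V) ->
  interpretation tau V U.
Proof.
move=> Usent wf h; split=> // phi phi_sent Vphi; apply: completeness => // M e eU.
have MU : models M U by move=> psi Upsi e'; rewrite (sat_sentence _ e (Usent _ Upsi)); apply: eU.
have [g [Q [q [qQ QV]]]] := h M (e 0) MU.
rewrite -(blocksK wf e) (sat_tr wf (e 0)).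
have [x xd] := good_inh g.
rewrite (rsat_below (e' := fun=> x) _ phi_sent) // (rsat_quotient g qQ) //.
by apply: (soundness Vphi) => psi Vpsi; apply: QV.
Qed.

Hypothesis int : interpretation tau V U.
Let wf : translation_wf tau := int.1.
Variables (M : struct K) (x0 : M).
Hypothesis MU : models M U.
Local Notation X := (tr_rstruct wf x0).

Lemma interpretation_rsat phi (e : nat -> X) : sentence phi -> prv V phi -> rsat e phi.
Proof.
move=> phi_sent Vphi; have := soundness (int.2 phi phi_sent Vphi).
by move=> /(_ _ (flat wf e)); rewrite (sat_tr wf x0); apply=> psi /MU.
Qed.

(** Logical validities are theorems of every [V], so their translations hold in [M]. Each clause
    comes from one validity: the existence of an object, a law of equality, totality of a function
    symbol or a congruence axiom. *)
Lemma interpretation_good : good X.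
Proof.
have valid_closed phi : sentence phi -> (forall (N : struct L) (e : nat -> N), sat e phi) ->
    forall e : nat -> X, rsat e phi.
  by move=> phi_sent h e; apply: interpretation_rsat => //; apply: valid_prv.
have [x xd] : exists x : X, rdom x.
  have := valid_closed (Ex Top) isT _ (fun=> fun=> x0).
  rewrite rsatEx; case=> [N e|x [xd _]]; last by exists x.
  by rewrite satEx; exists (e 0).
(* Free variables are handled by passing to a universal closure and instantiating it in the
   domain. *)
have valid phi : (forall (N : struct L) (e : nat -> N), sat e phi) ->
    forall e : nat -> X, (forall i, rdom (e i)) -> rsat e phi.
  move=> h e ed; have [k kP] := below_ex phi.
  have : rsat e (alls k phi).
    by apply: valid_closed => [|N e']; rewrite ?sat_alls // /sentence /= below_alls addn0.
  rewrite rsat_alls => /(_ e (fun i _ => ed i)).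
  by rewrite (rsat_below (e' := e) _ kP) // => i ->.
have extd n (z : 'I_n -> X) : (forall j, rdom (z j)) -> forall i, rdom (extend z x i).
  by move=> zd i; rewrite /extend; case: insubP.
(* One environment for two tuples and two elements: [y] and [y'] at indices 0 and 1, then the
   entries of [z] at even and those of [z'] at odd indices. *)
pose merge n (z z' : 'I_n -> X) (y y' : X) :=
  sc y (sc y' (fun i => if odd i then extend z' x i./2 else extend z x i./2)).
have merged n (z z' : 'I_n -> X) y y' : (forall j, rdom (z j)) -> (forall j, rdom (z' j)) ->
    rdom y -> rdom y' -> forall i, rdom (merge _ z z' y y' i).
  by move=> zd z'd yd yd' [|[|i]] //=; case: ifP => _; apply: extd.
have mergel n (z z' : 'I_n -> X) y y' (j : 'I_n) : merge _ z z' y y' j.*2.+2 = z j.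
  by rewrite /= odd_double doubleK extend_ord.
have merger n (z z' : 'I_n -> X) y y' (j : 'I_n) : merge _ z z' y y' j.*2.+3 = z' j.
  by rewrite /= odd_double uphalf_double extend_ord.
have refl (y : X) : rdom y -> req y y.
  move=> yd.
  have : rsat (fun=> y) (Eq (Var 0) (Var 0)) by apply: valid.
  by move=> [_ [_ [_ _ <- <-]]].
split=> //; first by exists x.
- move=> y z w yd zd wd yz yw.
  have : rsat (sc w (sc z (fun=> y)))
      (Imp (Eq (Var 2) (Var 1)) (Imp (Eq (Var 2) (Var 0)) (Eq (Var 1) (Var 0)))).
    by apply: valid => [N e /= -> ->|[|[]]].
  case=> [||_ [_ [_ _ <- <-]]//]; first by exists y, z.
  by exists y, w.
- move=> f z zd.
  have : rsat (extend z x) (Ex (Eq (@Fun L f (fun j => Var j.+1)) (Var 0))).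
    apply: valid (extd _ _ zd) => N e; rewrite satEx.
    by exists (fi (fun j : 'I_(far f) => e j)).
  rewrite rsatEx => -[y [yd [y1 [y2 [yd1 yd2 [z' [zd' hz' zy]] _ _]]]]].
  exists y1; split=> //; suff -> : z = z' by [].
  by apply/funext => j; rewrite -hz' /= extend_ord.
- move=> f z z' y y' zd zd' yd yd' zz' zy zy'.
  have : rsat (merge _ z z' y y') (Imp (Eq (@Fun L f (fun j => Var j.*2.+2)) (Var 0))
      (Imp (Eq (@Fun L f (fun j => Var j.*2.+3)) (Var 1))
      (Imp (\big[@And L/Top]_(j < far f) Eq (Var j.*2.+2) (Var j.*2.+3)) (Eq (Var 0) (Var 1))))).
    apply: valid (merged _ _ _ _ _ zd zd' yd yd') => N e /=.
    by rewrite sat_bigAnd /= => <- <- h; congr fi; apply/funext.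
  case=> [|||_ [_ [_ _ <- <-]]//].
  + exists y, y; split=> //; last exact: refl.
    by exists z; split=> // j; apply: (mergel _ z z' y y').
  + exists y', y'; split=> //; last exact: refl.
    by exists z'; split=> // j; apply: (merger _ z z' y y').
  + apply: rsat_bigAnd => j; exists (z j), (z' j); split=> //.
- move=> r z z' zd zd' zz' hz.
  have : rsat (merge _ z z' x x)
      (Imp (\big[@And L/Top]_(j < rar r) Eq (Var j.*2.+2) (Var j.*2.+3))
      (Imp (@Rel L r (fun j => Var j.*2.+2)) (@Rel L r (fun j => Var j.*2.+3)))).
    apply: valid (merged _ _ _ _ _ zd zd' xd xd) => N e /=.
    rewrite sat_bigAnd => h.
    rewrite (_ : (fun j : 'I_(rar r) => e j.*2.+2) = fun j => e j.*2.+3) //.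
    exact/funext.
  case=> [||w [_ hw]].
  + apply: rsat_bigAnd => j; exists (z j), (z' j); split=> //.
  + by exists z; split=> // j; apply: (mergel _ z z' x x).
  + suff -> : z' = w by [].
    by apply/funext => j; rewrite -hw; apply/esym/(merger _ z z' x x).
Qed.

End Interpretation.

(** * Interpretations of R as interpretations of Succ0 *)

Definition elim0 (T : Type) (j : 'I_0) : T.
Proof. by case: j. Defined.

Lemma elim0E (T : Type) (z z' : 'I_0 -> T) : z = z'.
Proof. by apply/funext => j; case: (elim0 False j). Qed.

Section SuccStructure.
Variable Q : struct sig_R.

Definition zeroQ : Q := @fi _ Q Zero_R (@elim0 Q).
Definition succQ (x : Q) : Q := @fi _ Q Succ_R (fun=> x).
Definition numQ (n : nat) : Q := iter n succQ zeroQ.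

Lemma eval_numR (e : nat -> Q) n : eval e (numR n) = numQ n.
Proof.
elim: n => [|n IH] /=; first by congr fi; apply: elim0E.
by congr fi; apply/funext => j; rewrite ord1.
Qed.

Definition succ_struct : struct sig_Succ0 :=
  @Struct sig_Succ0 Q (fun _ _ => zeroQ)
    (fun _ (z : 'I_2 -> Q) => succQ (z (@Ordinal 2 0 isT)) = z (@Ordinal 2 1 isT)).

Lemma sat_ntilde (e : nat -> succ_struct) n i : sat e (ntilde n i) = (e i = numQ n).
Proof.
elim: n e i => [//|n IH] e i; rewrite [ntilde _ _]/= satEx.
apply/propext; split=> [[x]|h].
  by rewrite satAnd IH /= => -[-> <-].
by exists (numQ n); rewrite satAnd IH.
Qed.

(** Since S is the graph of a function, n~ defines the single element [numQ n]. This settles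
    existence and uniqueness, and disjointness is the distinctness of the numerals. *)
Lemma succ_struct_models : (forall m n, m != n -> numQ m <> numQ n) -> models succ_struct Succ0.
Proof.
move=> neq _ [n|m n mn|n] e.
- by rewrite satEx; exists (numQ n); rewrite sat_ntilde.
- move=> x; rewrite satNot satAnd !sat_ntilde => -[/= ->]; apply: neq.
  by rewrite ltn_eqF.
- move=> x y h.
  have : sat (sc y (sc x e)) (And (ntilde n 1) (ntilde n 0)) := h.
  by rewrite satAnd !sat_ntilde /= => -[-> ->].
Qed.

End SuccStructure.

Section Induced.
Variables (L : signature) (N : translation sig_R L).
Hypothesis wf : translation_wf N.

Lemma induced_wf : translation_wf (induced N).
Proof.
have [d0 dom_b eqn_b fct_b _] := wf; split=> // [f|r]; first exact: (fct_b Zero_R).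
have := @below_tr _ _ N wf 2 (Eq (succR (Var 0)) (Var 1)); apply.
by rewrite /= andbT; apply/forallP => j; rewrite ord1.
Qed.

Variables (M : struct L) (x0 : M).
Local Notation X := (tr_rstruct wf x0).
Local Notation X' := (tr_rstruct induced_wf x0).
Hypothesis gX : good X.
Variables (Q : struct sig_R) (q : X -> Q).
Hypothesis qX : quotient q.

(** The two sides differ only in the proof that the dimension is positive. *)
Lemma flat_induced (B : nat -> 'I_(dim N) -> M) :
  @flat _ _ (induced N) M induced_wf B = flat wf B.
Proof. by apply/funext => v; congr (B _ _); apply: val_inj. Qed.

(** The relation is the translation of a formula of R, so it can be evaluated in the quotient. This
    shows both that it respects equality and what it becomes there. *)
Lemma rrel_induced (z : 'I_2 -> X) : (forall j, rdom (z j)) ->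
  @rrel _ X' tt z = (succQ (q (z (@Ordinal 2 0 isT))) = q (z (@Ordinal 2 1 isT))).
Proof.
move=> zd; transitivity (sat (flat induced_wf (extend z (fun=> x0)))
  (tr N (Eq (succR (Var 0)) (Var 1)))) => //.
rewrite flat_induced (sat_tr wf x0).
rewrite (@rsat_below _ _ 2 _ (extend z (z (@Ordinal 2 0 isT)))).
- rewrite (rsat_quotient gX qX) => [|i]; last by rewrite /extend; case: insubP.
  rewrite [LHS]/= /succQ; congr (fi _ = q _); last exact: (extend_ord z _ (@Ordinal 2 1 isT)).
  by apply/funext => j; rewrite ord1 /=; congr q; apply: (extend_ord z _ (@Ordinal 2 0 isT)).
- by move=> i i2; rewrite -[i]/(val (Ordinal i2)) !extend_ord.
- by rewrite /= andbT; apply/forallP => j; rewrite ord1.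
Qed.

Lemma induced_good : good X'.
Proof.
have [inh refl eucl tot fct rel] := gX.
have domE x : @rdom _ X' x = @rdom _ X x by rewrite /= flat_induced.
have eqE x y : @req _ X' x y = @req _ X x y by rewrite /= flat_induced.
split.
- by have [x xd] := inh; exists x; rewrite domE.
- by move=> x; rewrite domE eqE; apply: refl.
- by move=> x y z; rewrite !domE !eqE; apply: eucl.
- move=> f z zd; have [|y [yd zy]] := tot Zero_R z; first by move=> j; rewrite -domE.
  by exists y; rewrite domE; split=> //; rewrite /= flat_induced.
- move=> f z z' y y' zd zd' yd yd' zz'; rewrite eqE /= !flat_induced => zy zy'.
  by apply: (fct Zero_R z z' y y') => *; rewrite -?domE -?eqE.
- case=> z z' zd zd' zz'; rewrite !rrel_induced => [|j|j]; rewrite -?domE //.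
  have qE j : q (z j) = q (z' j) by rewrite (quo_eq qX) -?domE -?eqE.
  by rewrite !qE.
Qed.

Lemma induced_quotient : @quotient _ X' (succ_struct Q) q.
Proof.
have domE x : @rdom _ X' x = @rdom _ X x by rewrite /= flat_induced.
have eqE x y : @req _ X' x y = @req _ X x y by rewrite /= flat_induced.
split.
- by move=> c; have [x xd <-] := quo_surj qX c; exists x; rewrite ?domE.
- by move=> x y; rewrite !domE eqE; apply: quo_eq.
- move=> f z y zd yd; rewrite /= flat_induced /zeroQ => zy.
  rewrite -(@quo_fct _ _ _ _ qX Zero_R z y) //; first by congr fi; apply: elim0E.
    by move=> j; rewrite -domE.
  by rewrite -domE.
- by case=> z zd; rewrite rrel_induced // => j; rewrite -domE.
Qed.

Lemma sat_induced_ntilde n i (B : nat -> X) : (forall b, rdom (B b)) ->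
  sat (flat wf B) (tr (induced N) (ntilde n i)) = (q (B i) = numQ Q n).
Proof.
move=> Bd; rewrite -flat_induced (sat_tr induced_wf x0).
rewrite (rsat_quotient induced_good induced_quotient) ?sat_ntilde // => b.
by rewrite /= flat_induced; apply: Bd.
Qed.

End Induced.

Lemma interpretation_induced (L : signature) (U : set (form L)) (N : translation sig_R L) :
  U `<=` @sentence L -> interpretation N TheoryR U -> interpretation (induced N) Succ0 U.
Proof.
move=> Usent int; apply: (interpretation_intro Usent (wf := induced_wf int.1)) => M x0 MU.
have gX := interpretation_good int x0 MU; have [Q [q qX]] := quotient_exists gX.
split; first exact: (induced_good gX qX).
exists (succ_struct Q), q; split; first exact: induced_quotient.
apply: succ_struct_models => m n mn.
have [x xd] := good_inh gX.
have numR_sent k : term_below 0 (numR k).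
  by elim: k => [|k IH] /=; apply/forallP => j; rewrite ?ord1 //; case: (elim0 False j).
have : @rsat _ (tr_rstruct int.1 x0) (fun=> x) (Not (Eq (numR m) (numR n))).
  by apply: (interpretation_rsat MU); [rewrite /sentence /= !numR_sent|apply/prv_ax/R_neq].
by rewrite (rsat_quotient gX qX) //= !eval_numR.
Qed.

(** * Numbers in models of VS *)

Section SetModel.
Variables (D : eqType) (mem : D -> D -> Prop).
Hypothesis finset_ex : forall s : seq D, exists x, forall y, mem y x <-> y \in s.

(** Russell's paradox relative to [s]: the set of those members of [s] that do not belong to
    themselves cannot be in [s]. *)
Lemma fresh_ex (s : seq D) : exists x, x \notin s.
Proof.
have [x xP] := finset_ex [seq y <- s | ~~ `[< mem y y >]].
exists x; apply/negP => xs; have := xP x; rewrite mem_filter xs andbT.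
by case: asboolP => h [h1 h2]; [have := h1 h|apply: h; apply: h2].
Qed.

Definition upair p a b := forall y, mem y p <-> y = a \/ y = b.

(** Kuratowski pairs. Without extensionality one pair may have many codes [p]. *)
Definition pr p a b := exists u v, [/\ upair u a a, upair v a b & upair p u v].

Lemma upair_ex a b : exists p, upair p a b.
Proof.
have [p pP] := finset_ex [:: a; b]; exists p => y; rewrite pP !inE.
by split=> [/orP[/eqP->|/eqP->]|[->|->]]; rewrite ?eqxx ?orbT; auto.
Qed.

Lemma pr_ex a b : exists p, pr p a b.
Proof.
have [u uP] := upair_ex a a; have [v vP] := upair_ex a b; have [p pP] := upair_ex u v.
by exists p, u, v.
Qed.

(** The usual argument survives without extensionality: [u] and [v] are members of [p], hence
    identical as objects, and not merely in extension, to [u'] or [v']. *)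
Lemma pr_inj p a b a' b' : pr p a b -> pr p a' b' -> a = a' /\ b = b'.
Proof.
move=> [u [v [uP vP pP]]] [u' [v' [uP' vP' pP']]].
have upair_sub q c c' e e' : upair q c c' -> upair q e e' -> c = e \/ c = e'.
  by move=> h h'; apply/h'/h; left.
have upairC q c c' : upair q c c' -> upair q c' c.
  by move=> h y; rewrite h; tauto.
have aa' : a = a'.
  have [uu'|uv'] := upair_sub _ _ _ _ _ pP pP'.
    by rewrite -uu' in uP'; have [] := upair_sub _ _ _ _ _ uP uP'.
  rewrite -uv' in vP'; have [//|ab] := upair_sub _ _ _ _ _ uP vP'.
  by have [] := upair_sub _ _ _ _ _ vP' uP.
split=> //; subst a'.
have bb w c c' : upair w a c -> upair w a c' -> c = c'.
  move=> h h'; have [ca|//] := upair_sub _ _ _ _ _ (upairC _ _ _ h) h'.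
  have [c'a|//] := upair_sub _ _ _ _ _ (upairC _ _ _ h') h.
  by rewrite ca c'a.
have [vu'|vv'] := upair_sub _ _ _ _ _ (upairC _ _ _ pP) pP'; last first.
  by apply: (bb v) => //; rewrite vv'.
have ba : b = a by apply: (bb v) => //; rewrite vu'.
have [v'u|v'v] := upair_sub _ _ _ _ _ (upairC _ _ _ pP') pP.
  by rewrite ba; apply: (bb v') => //; rewrite v'u.
by apply: (bb v) => //; rewrite -v'v.
Qed.

Definition app f u v := exists p, mem p f /\ pr p u v.

Lemma graph_ex (l : seq (D * D)) : exists f, forall u v, app f u v <-> (u, v) \in l.
Proof.
have [c cP] := choice (fun uv : D * D => pr_ex uv.1 uv.2).
have [f fP] := finset_ex (map c l); exists f => u v; split=> [[p [/fP/mapP[[u' v'] l' ->]]]|uv].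
  by move=> /(pr_inj (cP _)) /= [<- <-].
by exists (c (u, v)); split; [apply/fP/map_f|apply: (cP (u, v))].
Qed.

Definition le x y := exists f,
  (forall u, mem u x -> exists v, mem v y /\ app f u v) /\
  (forall u u' v, mem u x -> mem u' x -> app f u v -> app f u' v -> u = u').

Definition card n x := exists s, [/\ uniq s, size s = n & forall y, mem y x <-> y \in s].

Lemma card_ex n : exists x, card n x.
Proof.
have [s [us sn]] : exists s : seq D, uniq s /\ size s = n.
  elim: n => [|n [s [us sn]]]; first by exists [::].
  by have [x xs] := fresh_ex s; exists (x :: s) => /=; rewrite xs us sn.
by have [x xP] := finset_ex s; exists x, s.
Qed.

Lemma card_inj m n x : card m x -> card n x -> m = n.
Proof.
move=> [s [us <- sP]] [s' [us' <- sP']]; apply/eqP.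
rewrite -(uniq_size_uniq us') // => y; apply/idP/idP.
  by move=> /sP' /sP.
by move=> /sP /sP'.
Qed.

Lemma sub_card s x : (forall y, mem y x -> y \in s) -> exists2 m, m <= size s & card m x.
Proof.
move=> xs; set s' := [seq y <- undup s | `[< mem y x >]].
exists (size s'); first by rewrite size_filter (leq_trans (count_size _ _)) // size_undup.
exists s'; split=> // [|y]; first by rewrite filter_uniq // undup_uniq.
rewrite mem_filter mem_undup; split=> [h|/andP[/asboolP //]].
by rewrite asboolT // xs.
Qed.

(** Read backwards, the relation is a partial function from [y] onto [x], extended here by junk
    values to [g]. *)
Lemma le_card n x y : card n y -> le x y -> exists2 m, m <= n & card m x.
Proof.
move=> [s [us <- sP]] [f [ftot finj]].
have [g gP] : exists g : D -> D, forall v u, mem u x -> app f u v -> g v = u.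
  have /choice[g gP] v : exists w, forall u, mem u x -> app f u v -> w = u.
    have [[w [wx fw]]|h] := EM (exists w, mem w x /\ app f w v).
      by exists w => u ux fu; apply: finj fw fu.
    by exists v => u ux fu; case: h; exists u.
  by exists g.
have [u ux|m] := @sub_card (map g s) x; last by rewrite size_map; exists m.
have [v [vy fuv]] := ftot _ ux.
by apply/mapP; exists v; [apply/sP|rewrite (gP v u)].
Qed.

Lemma card_le m x y s : card m x -> uniq s -> m <= size s -> (forall z, z \in s -> mem z y) ->
  le x y.
Proof.
move=> [r [ur rm rP]] us ms sy.
have [f fP] := graph_ex (zip r s).
have zipP u v : (u, v) \in zip r s -> index u r = index v s /\ v \in s.
  move=> /(nthP (u, v))[i]; rewrite size_zip leq_min => /andP[ir is_].
  rewrite nth_zip_cond size_zip leq_min ir is_ /= => -[<- <-].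
  by rewrite !index_uniq // mem_nth.
exists f; split=> [u /rP ur'|u u' v /rP ux /rP u'x /fP/zipP[h _] /fP/zipP[h' _]]; last first.
  by rewrite -(nth_index u ux) h -h' nth_index.
have iu : index u r < size s by rewrite (leq_trans _ ms) // -rm index_mem.
exists (nth u s (index u r)); split; first by apply/sy/mem_nth.
apply/fP; apply/(nthP (u, u)); exists (index u r).
  by rewrite size_zip leq_min index_mem ur' iu.
by rewrite nth_zip_cond size_zip leq_min index_mem ur' iu /= nth_index.
Qed.

(** Distinct members of [y] can be picked one after the other: a list containing all of them would
    give [y] a cardinality. *)
Lemma infinite_le m x y : card m x -> (forall n, ~ card n y) -> le x y.
Proof.
move=> xm yinf; suff [s [us sm sy]] :
    exists s, [/\ uniq s, size s = m & forall z, z \in s -> mem z y].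
  by apply: card_le xm us _ sy; rewrite sm.
elim: m {xm} => [|m [s [us sm sy]]]; first by exists [::].
have [z [zy zs]] : exists z, mem z y /\ z \notin s.
  apply: contrapT => h; have [z zy|n _] := @sub_card s y; last exact: yinf.
  by apply: contrapT => zs; apply: h; exists z; split=> //; apply/negP.
exists (z :: s); split=> [|/=|w]; rewrite /= ?zs ?sm // inE => /predU1P[->//|].
exact: sy.
Qed.

Definition equi x y := le x y /\ le y x.

(** With one side finite, Cantor-Bernstein is a matter of counting. *)
Lemma equi_card n x y : card n x -> equi x y <-> card n y.
Proof.
move=> xn; split=> [[xy yx]|yn].
  have [m mn ym] := le_card xn yx; have [n' nm xn'] := le_card ym xy.
  by rewrite -(card_inj xn xn') in nm; have -> : n = m by apply/eqP; rewrite eqn_leq nm mn.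
split.
  by have [s [us sn sP]] := yn; apply: card_le xn us _ _ => [|z /sP]; rewrite ?sn.
by have [s [us sn sP]] := xn; apply: card_le yn us _ _ => [|z /sP]; rewrite ?sn.
Qed.

Lemma equiC x y : equi x y <-> equi y x. Proof. by rewrite /equi; tauto. Qed.

(* The number n is represented by the pairs <x, x> where x has n elements.  The
   pairs <t, x> with t <> x are used to make the order of every element with
   respect to the numerals total. *)
Definition std n p := exists x, pr p x x /\ card n x.

Definition pre_eqv p q := p = q \/ exists x y, [/\ pr p x x, pr q y y & equi x y].

(** Injections need not compose in a model of VS, so [pre_eqv] may fail to be transitive. Having the
    same neighbours is an equivalence in any case. *)
Definition eqv p q := forall r, pre_eqv p r <-> pre_eqv q r.

Lemma eqvC p q : eqv p q -> eqv q p. Proof. by move=> h r; rewrite h. Qed.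

Lemma eqv_trans p q r : eqv p q -> eqv q r -> eqv p r.
Proof. by move=> h h' s; rewrite h. Qed.

Lemma std_ex n : exists p, std n p.
Proof. by have [x xn] := card_ex n; have [p px] := pr_ex x x; exists p, x. Qed.

Lemma std_inj m n p : std m p -> std n p -> m = n.
Proof. by move=> [x [px xm]] [y [/(pr_inj px)[<- _]]]; apply: card_inj. Qed.

Lemma std_pre_eqv n p q : std n p -> pre_eqv p q <-> std n q.
Proof.
move=> [x [px xn]]; split=> [[<-|[x' [y [px' qy xy]]]]|[y [qy yn]]]; first by exists x.
  by exists y; split=> //; apply/(equi_card y xn); have [->] := pr_inj px px'.
by right; exists x, y; split=> //; apply/(equi_card y xn).
Qed.

(** Nothing changes for numerals in passing from [pre_eqv] to [eqv]: the neighbours of a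
    representative of n are precisely the representatives of n. *)
Lemma std_eqv n p q : std n p -> eqv p q <-> std n q.
Proof.
move=> pn; split=> [h|qn r]; last by rewrite (std_pre_eqv _ pn) (std_pre_eqv _ qn).
have : pre_eqv q p by apply/h; left.
move=> [-> //|[y [x [qy px xy]]]]; have [x' [/(pr_inj px)[<- _] xn]] := pn.
by exists y; split=> //; apply/(equi_card y xn)/equiC.
Qed.

(** A tagged pair is a neighbour of itself only, as the other case of [pre_eqv] concerns pairs with
    equal components. *)
Lemma eqv_tagged t x p q : pr p t x -> t <> x -> eqv p q -> p = q.
Proof.
move=> px tx /(_ p)[/(_ (or_introl erefl))[//|[y [z [_ pz _]]]] _].
by case: tx; have [-> ->] := pr_inj px pz.
Qed.

Section Totalisation.
Variable G : D -> D -> D -> Prop.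

(** [G] itself may distinguish equal arguments; closing it under [eqv] makes [determined] a property
    of the classes. *)
Definition eqv_graph x y w := exists x' y', [/\ eqv x x', eqv y y' & G x' y' w].
Definition determined x y := (exists w, eqv_graph x y w) /\
  forall w w', eqv_graph x y w -> eqv_graph x y w' -> eqv w w'.
(* The junk value is the second argument, so that z + y can only be a numeral n for
   a numeral y <= n, as the axioms of R on the order demand. *)
Definition totalise x y w :=
  determined x y /\ eqv_graph x y w \/ ~ determined x y /\ eqv y w.

Lemma eqv_graph_eqv x y x' y' w : eqv x x' -> eqv y y' -> eqv_graph x y w -> eqv_graph x' y' w.
Proof.
move=> xx' yy' [u [v [xu yv uvw]]]; exists u, v; split=> //.
  exact: eqv_trans (eqvC xx') xu.
exact: eqv_trans (eqvC yy') yv.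
Qed.

Lemma determined_eqv x y x' y' : eqv x x' -> eqv y y' -> determined x y -> determined x' y'.
Proof.
move=> xx' yy' [[w xyw] h]; split; first by exists w; apply: eqv_graph_eqv xyw.
by move=> u v hu hv; apply: h; [apply: eqv_graph_eqv hu|apply: eqv_graph_eqv hv]; apply: eqvC.
Qed.

Lemma totalise_ex x y : exists w, totalise x y w.
Proof.
have [h|h] := EM (determined x y); last by exists y; right.
by have [w xyw] := h.1; exists w; left.
Qed.

Lemma totalise_fun x y x' y' w w' : eqv x x' -> eqv y y' ->
  totalise x y w -> totalise x' y' w' -> eqv w w'.
Proof.
move=> xx' yy' h [[h1 h2]|[h1 h2]].
  have h1' := determined_eqv (eqvC xx') (eqvC yy') h1.
  case: h => [[_ h]|[]//]; apply: h1.2 h2; exact: eqv_graph_eqv h.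
case: h => [[/(determined_eqv xx' yy')]//|[_ h]].
exact: eqv_trans (eqvC h) (eqv_trans yy' h2).
Qed.

Lemma totalise_graph x y w :
  eqv_graph x y w -> (forall w', eqv_graph x y w' -> eqv w w') -> totalise x y w.
Proof.
move=> xyw h; left; split=> //; split; first by exists w.
by move=> u v /h wu /h wv; apply: eqv_trans wv; apply: eqvC.
Qed.

(** Whatever equals a numeral is again a representative of it, so on numerals all values of the
    closed graph represent k. The graph is thus determined there and the junk branch does not
    arise. *)
Lemma totalise_std m n k x y w :
  (forall x y w, std m x -> std n y -> G x y w -> std k w) ->
  (forall x y, std m x -> std n y -> exists w, G x y w) ->
  std m x -> std n y -> totalise x y w -> std k w.
Proof.
move=> Gk Gex xm yn xyw; have [w' xyw'] := Gex x y xm yn.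
have graph_std v : eqv_graph x y v -> std k v.
  move=> [x' [y' [xx' yy' h]]]; apply: Gk h; first exact/(std_eqv _ xm).
  exact/(std_eqv _ yn).
have hw' : eqv_graph x y w' by exists x, y.
have w'k := graph_std _ hw'.
apply/(std_eqv _ w'k); apply: totalise_fun (totalise_graph hw' _) xyw => //.
by move=> v /graph_std vk; apply/(std_eqv _ w'k).
Qed.

End Totalisation.

Definition dunion a b c := (forall y, mem y c <-> mem y a \/ mem y b) /\
  forall y, ~ (mem y a /\ mem y b).

Lemma dunion_card m n a b c : card m a -> card n b -> dunion a b c -> card (m + n) c.
Proof.
move=> [s [us <- sP]] [r [ur <- rP]] [cP dis]; exists (s ++ r); split=> [||y].
- rewrite cat_uniq us ur andbT /=; apply/negP => /hasP[y /rP yb /sP ya].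
  by case: (dis y).
- by rewrite size_cat.
- by rewrite mem_cat cP sP rP; split=> /orP.
Qed.

(* The second clause lets a tagged pair z = <t, w> serve as the difference w - y
   whenever w is not a numeral smaller than y. *)
Definition add_graph z y w :=
  (exists a b c, [/\ pr z a a, pr y b b, pr w c c
     & exists a' b', [/\ equi a a', equi b b' & dunion a' b' c]]) \/
  (exists t b, [/\ pr z t w, t <> w, pr y b b & forall c, pr w c c -> le b c]).

Definition add := totalise add_graph.

(** A numeral is not a tagged pair, so only the first clause of [add_graph] applies. Its
    equinumerous copies allow for summands that overlap; for existence they are an initial and a
    final part of a set with m + n elements. *)
Lemma add_std m n x y w : std m x -> std n y -> add x y w -> std (m + n) w.
Proof.
apply: totalise_std => {x y w}[x y w|x y] [a [xa am]] [b [yb bn]].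
  move=> [[a1 [b1 [c [xa1 yb1 wc [a' [b' [aa' bb' cP]]]]]]]|[t [b1 [xt tw _ _]]]].
    have [ea _] := pr_inj xa xa1; have [eb _] := pr_inj yb yb1; subst a1 b1.
    by exists c; split=> //; apply: dunion_card cP; apply/equi_card; eassumption.
  by case: tw; have [<- <-] := pr_inj xa xt.
have [c0 [s [us sz sP]]] := card_ex (m + n).
have [a' a'P] := finset_ex (take m s); have [b' b'P] := finset_ex (drop m s).
have [c cP] := finset_ex s; have [w wc] := pr_ex c c.
have us' : uniq (take m s ++ drop m s) by rewrite cat_take_drop.
exists w; left; exists a, b, c; split=> //; exists a', b'; split.
- apply/(equi_card _ am); exists (take m s); split=> //; first exact: take_uniq.
  by rewrite size_takel // sz leq_addr.
- apply/(equi_card _ bn); exists (drop m s); split=> //; first exact: drop_uniq.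
  by rewrite size_drop sz addKn.
- split=> y'; rewrite a'P b'P; first by rewrite cP -{1}(cat_take_drop m s) mem_cat; split=> /orP.
  by move: us'; rewrite cat_uniq => /and3P[_ /hasPn h _] [ht /h]; rewrite ht.
Qed.

(** In the first clause of [add_graph] the set of [x] injects into a part of the set of [w], in the
    second the bound is imposed, and a junk sum equals [x] itself. *)
Lemma add_bounded n z x w : std n w -> add z x w -> exists2 m, m <= n & std m x.
Proof.
move=> wn; suff graph x' : add_graph z x' w \/ (exists z', add_graph z' x' w) ->
    exists2 m, m <= n & std m x'.
  move=> [[_ [z' [x' [_ xx' h]]]]|[_ xw]]; last first.
    by exists n => //; apply/(std_eqv _ wn)/eqvC.
  have [m mn x'm] := graph x' (or_intror (ex_intro _ z' h)).
  by exists m => //; apply/(std_eqv _ x'm)/eqvC.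
suff {z}graph z : add_graph z x' w -> exists2 m, m <= n & std m x'.
  by move=> [|[z']]; apply: graph.
have [c [wc cn]] := wn.
have fin b : pr x' b b -> le b c -> exists2 m, m <= n & std m x'.
  by move=> x'b /(le_card cn)[m mn bm]; exists m => //; exists b.
move=> [[a1 [b [c1 [_ x'b /(pr_inj wc)[<- _] [a' [b' [_ [bb' _] [cP _]]]]]]]]|]; last first.
  by move=> [t [b [_ _ x'b /(_ _ wc)]]]; apply: fin.
have [s [us sn sP]] := cn.
have [y yb'|m mn b'm] := @sub_card s b'; first by apply/sP/cP; right.
rewrite sn in mn; have [k km bk] := le_card b'm bb'.
by exists k; [apply: leq_trans mn|exists b].
Qed.

(** Numerals are compared by subtraction. Any other [x] is above every numeral: tag it with some t
    other than [x], and let z be the pair <t, x>; then z + y is [x]. Should [x] be a pair <c, c>,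
    then c is infinite and the bound in [add_graph] holds. The sum is unique because z is alone in
    its class. *)
Lemma add_total n x y : std n y ->
  (exists z w, std n w /\ add z x w) \/ (exists z w, eqv w x /\ add z y w).
Proof.
move=> yn; have [[m xm]|xinf] := EM (exists m, std m x).
  have [mn|/ltnW nm] := leqP m n; [left|right].
    have [z zk] := std_ex (n - m); have [w h] := totalise_ex add_graph z x.
    by exists z, w; split=> //; have := add_std zk xm h; rewrite subnK.
  have [z zk] := std_ex (m - n); have [w h] := totalise_ex add_graph z y.
  by exists z, w; split=> //; have := add_std zk yn h; rewrite subnK // => wm; apply/(std_eqv _ wm).
right; have [t] := fresh_ex [:: x]; rewrite inE => /eqP tx; have [z zt] := pr_ex t x.
exists z, x; split=> //; apply: totalise_graph.
  exists z, y; split=> //; right; have [b [yb bn]] := yn; exists t, b; split=> //.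
  move=> c xc; apply: infinite_le bn _ => k ck; apply: xinf; exists k, c; split=> //.
move=> w [z' [y' [/(eqv_tagged zt tx) <- _ h]]].
case: h => [[a [_ [_ [za _ _ _]]]]|[t' [_ [zt' _ _ _]]]].
  by case: tx; have [-> ->] := pr_inj zt za.
by have [_ ->] := pr_inj zt zt'.
Qed.

(** The last clause admits a single code for each pair; otherwise [c] could contain several codes of
    one pair and have too many elements. *)
Definition mul_graph x y w := exists a b c, [/\ pr x a a, pr y b b, pr w c c
  & [/\ forall p, mem p c -> exists u v, [/\ mem u a, mem v b & pr p u v],
       forall u v, mem u a -> mem v b -> exists p, mem p c /\ pr p u v
     & forall p p' u v, mem p c -> mem p' c -> pr p u v -> pr p' u v -> p = p']].

Definition mul := totalise mul_graph.

Lemma mul_std m n x y w : std m x -> std n y -> mul x y w -> std (m * n) w.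
Proof.
apply: totalise_std => {x y w}[x y w|x y] [a [xa am]] [b [yb bn]].
  move=> [a1 [b1 [c [xa1 yb1 wc [h1 h2 h3]]]]].
  have [ea _] := pr_inj xa xa1; have [eb _] := pr_inj yb yb1; subst a1 b1.
  exists c; split=> //; have [s [us <- sP]] := am; have [r [ur <- rP]] := bn.
  (* [P] selects the code that lies in [c]; for pairs outside the product it takes the junk value
     [x]. *)
  have /choice[P PP] (uv : D * D) : exists p, mem uv.1 a -> mem uv.2 b -> mem p c /\ pr p uv.1 uv.2.
    have [[ua vb]|h] := EM (mem uv.1 a /\ mem uv.2 b); last by exists x => ua vb; case: h.
    by have [p hp] := h2 _ _ ua vb; exists p.
  exists [seq P (u, v) | u <- s, v <- r]; split=> [||p].
  - apply: allpairs_uniq => // -[u v] [u' v'] /allpairsP[[? ?] [/sP ua /rP vb [-> ->]]].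
    move=> /allpairsP[[? ?] [/sP ua' /rP vb' [-> ->]]] /= e.
    have [_] := PP (_, _) ua vb; have [_] := PP (_, _) ua' vb'; rewrite /= in e *.
    by rewrite e => h h'; have [-> ->] := pr_inj h h'.
  - by rewrite size_allpairs.
  - split=> [pc|/allpairsP[[u v] /= [/sP ua /rP vb ->]]]; last by case: (PP (u, v)).
    have [u [v [ua vb puv]]] := h1 _ pc; apply/allpairsP; exists (u, v).
    split; try exact/sP; try exact/rP.
    by have [h h'] := PP (u, v) ua vb; apply: h3 puv h'.
have [P PP] := choice (fun uv : D * D => pr_ex uv.1 uv.2).
have [s [us _ sP]] := am; have [r [ur _ rP]] := bn.
have [c cP] := finset_ex [seq P (u, v) | u <- s, v <- r]; have [w wc] := pr_ex c c.
exists w, a, b, c; split=> //; split=> [p /cP/allpairsP[[u v] /= [us' vr ->]]|u v ua vb|].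
- by exists u, v; split; [apply/sP|apply/rP|apply: (PP (u, v))].
- exists (P (u, v)); split; last exact: (PP (u, v)).
  by apply/cP/allpairsP; exists (u, v); split=> //; [apply/sP|apply/rP].
- move=> p p' u v /cP/allpairsP[[u1 v1] [_ _ ->]] /cP/allpairsP[[u2 v2] [_ _ ->]] /=.
  move=> /(pr_inj (PP _)) /= [-> ->] /(pr_inj (PP _)) /= [-> ->] //.
Qed.

End SetModel.

(** * Formulas of set theory and their intended meaning *)

Section RelationalFormulas.
Variables (R : countType) (ar : R -> nat) (m : R).
Local Notation S := (@Signature void R (fun=> 0) ar).

(* Formulas with variables as the only terms whose satisfaction [fsat] reduces to
   the intended shallow proposition; [m] is the membership symbol. *)
Inductive fo : Type :=
| FEq of nat & nat
| FMem of nat & nat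
| FRel of R & seq nat
| FNot of fo
| FAnd of fo & fo
| FAnd3 of fo & fo & fo
| FAnd4 of fo & fo & fo & fo
| FOr of fo & fo
| FImp of fo & fo
| FIff of fo & fo
| FEx of fo
| FAll of fo.

Fixpoint compile (phi : fo) : form S :=
  match phi with
  | FEq i j => Eq (Var i) (Var j)
  | FMem i j => @Rel S m (args [:: Var i; Var j])
  | FRel r s => @Rel S r (fun k => Var (nth 0 s k))
  | FNot phi => Not (compile phi)
  | FAnd phi psi => And (compile phi) (compile psi)
  | FAnd3 phi psi chi => And (compile phi) (And (compile psi) (compile chi))
  | FAnd4 phi psi chi xi =>
      And (compile phi) (And (compile psi) (And (compile chi) (compile xi)))
  | FOr phi psi => Or (compile phi) (compile psi)
  | FImp phi psi => Imp (compile phi) (compile psi)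
  | FIff phi psi => Iff (compile phi) (compile psi)
  | FEx phi => Ex (compile phi)
  | FAll phi => All (compile phi)
  end.

Fixpoint fbelow (k : nat) (phi : fo) : bool :=
  match phi with
  | FEq i j | FMem i j => (i < k) && (j < k)
  | FRel r s => all (fun i => nth 0 s i < k) (iota 0 (ar r))
  | FNot phi => fbelow k phi
  | FAnd phi psi | FOr phi psi | FImp phi psi | FIff phi psi => fbelow k phi && fbelow k psi
  | FAnd3 phi psi chi => [&& fbelow k phi, fbelow k psi & fbelow k chi]
  | FAnd4 phi psi chi xi => [&& fbelow k phi, fbelow k psi, fbelow k chi & fbelow k xi]
  | FEx phi | FAll phi => fbelow k.+1 phi
  end.

Hypothesis ar_m : ar m = 2.

Lemma below_compile k phi : fbelow k phi -> below k (compile phi).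
Proof.
elim: phi k => //=.
- move=> i j k /andP[ik jk]; apply/forallP => -[a]; rewrite /args /= ar_m.
  by case: a => [|[|]].
- move=> r s k /allP h; apply/forallP => a; apply: h.
  by rewrite mem_iota ltn_ord.
- by move=> phi IH k h; rewrite IH.
- by move=> phi IH1 psi IH2 k /andP[h1 h2]; rewrite IH1 ?IH2.
- by move=> phi IH1 psi IH2 chi IH3 k /and3P[h1 h2 h3]; rewrite IH1 ?IH2 ?IH3.
- by move=> phi IH1 psi IH2 chi IH3 xi IH4 k /and4P[h1 h2 h3 h4];
    rewrite IH1 ?IH2 ?IH3 ?IH4.
- by move=> phi IH1 psi IH2 k /andP[h1 h2]; rewrite IH1 ?IH2.
- by move=> phi IH1 psi IH2 k /andP[h1 h2]; rewrite IH1 ?IH2.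
- by move=> phi IH1 psi IH2 k /andP[h1 h2]; rewrite IH1 ?IH2.
- by move=> phi IH k h; rewrite IH.
- by move=> phi IH k; apply: IH.
Qed.

Section Semantics.
Variables (D : Type) (rl : forall r, ('I_(ar r) -> D) -> Prop).

Definition rel_struct : struct S := @Struct S D (fun f => match f with end) rl.

Definition mem_rel (x y : D) : Prop := rl (fun k : 'I_(ar m) => nth x [:: x; y] k).

Fixpoint fsat (e : nat -> D) (phi : fo) : Prop :=
  match phi with
  | FEq i j => e i = e j
  | FMem i j => mem_rel (e i) (e j)
  | FRel r s => rl (fun k : 'I_(ar r) => e (nth 0 s k))
  | FNot phi => ~ fsat e phi
  | FAnd phi psi => fsat e phi /\ fsat e psi
  | FAnd3 phi psi chi => [/\ fsat e phi, fsat e psi & fsat e chi]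
  | FAnd4 phi psi chi xi => [/\ fsat e phi, fsat e psi, fsat e chi & fsat e xi]
  | FOr phi psi => fsat e phi \/ fsat e psi
  | FImp phi psi => fsat e phi -> fsat e psi
  | FIff phi psi => fsat e phi <-> fsat e psi
  | FEx phi => exists x, fsat (sc x e) phi
  | FAll phi => forall x, fsat (sc x e) phi
  end.

Lemma sat_compile (e : nat -> rel_struct) phi : sat e (compile phi) = fsat e phi.
Proof.
elim: phi e => [i j|i j|r s|phi IH|phi IH1 psi IH2|phi IH1 psi IH2 chi IH3
    |phi IH1 psi IH2 chi IH3 xi IH4|phi IH1 psi IH2|phi IH1 psi IH2|phi IH1 psi IH2
    |phi IH|phi IH] e; rewrite [compile _]/= //.
- congr (rl _); apply/funext => -[k kP] /=; rewrite /args /=; move: kP; rewrite ar_m.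
  by case: k => [|[|]].
- by rewrite satNot IH.
- by rewrite satAnd IH1 IH2.
- by rewrite satAnd satAnd IH1 IH2 IH3; apply/propext; split=> [[? []]|[]].
- by rewrite satAnd satAnd satAnd IH1 IH2 IH3 IH4; apply/propext; split=> [[? [? []]]|[]].
- by rewrite satOr IH1 IH2.
- by rewrite /= IH1 IH2.
- by rewrite satIff IH1 IH2.
- by rewrite satEx; apply/propext; split=> -[x h]; exists x; move: h; rewrite IH.
- change ((forall x, sat (sc x e) (compile phi)) = forall x, fsat (sc x e) phi).
  by apply/propext; split=> h x; [rewrite -IH|rewrite IH]; apply: h.
Qed.

End Semantics.

Section Direct.
Variables (L : signature) (tau : translation S L) (wf : translation_wf tau).
Variables (M : struct L) (x0 : M).
Local Notation X := (tr_rstruct wf x0).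
Hypothesis domT : forall x : X, rdom x.
Hypothesis eqnE : forall x y : X, req x y = (x = y).

(** With full domain and identity as equality, the blocks already form a structure, and the identity
    map is a quotient. *)
Lemma sat_tr_direct (B : nat -> X) (phi : form S) :
  sat (flat wf B) (tr tau phi) = @sat _ (rel_struct (@rrel _ X)) B phi.
Proof.
rewrite (sat_tr wf x0) (@rsat_quotient _ X (rel_struct (@rrel _ X)) id) //.
- split=> //; try by move=> x y z _ _ _; rewrite !eqnE => -> ->.
  + by exists (fun=> x0).
  + by move=> x; rewrite eqnE.
  + move=> r z z' _ _ zz'; suff -> : z = z' by [].
    by apply/funext => j; rewrite -eqnE.
- by split=> // c; exists c.
Qed.

End Direct.

Section SetFormulas.
Definition fupair p a b := FAll (FIff (FMem 0 p.+1) (FOr (FEq 0 a.+1) (FEq 0 b.+1))).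
Definition fpr p a b :=
  FEx (FEx (FAnd3 (fupair 1 a.+2 a.+2) (fupair 0 a.+2 b.+2) (fupair p.+2 1 0))).
Definition fapp f u v := FEx (FAnd (FMem 0 f.+1) (fpr 0 u.+1 v.+1)).
Definition fle x y :=
  FEx (FAnd (FAll (FImp (FMem 0 x.+2) (FEx (FAnd (FMem 0 y.+3) (fapp 2 1 0)))))
    (FAll (FAll (FAll (FImp (FMem 2 x.+4) (FImp (FMem 1 x.+4)
      (FImp (fapp 3 2 0) (FImp (fapp 3 1 0) (FEq 2 1))))))))).
Definition fequi x y := FAnd (fle x y) (fle y x).
Definition fpre_eqv p q :=
  FOr (FEq p q) (FEx (FEx (FAnd3 (fpr p.+2 1 1) (fpr q.+2 0 0) (fequi 1 0)))).
Definition feqv p q := FAll (FIff (fpre_eqv p.+1 0) (fpre_eqv q.+1 0)).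
Definition fgraph (G : nat -> nat -> nat -> fo) x y w :=
  FEx (FEx (FAnd3 (feqv x.+2 1) (feqv y.+2 0) (G 1 0 w.+2))).
Definition fdetermined G x y :=
  FAnd (FEx (fgraph G x.+1 y.+1 0))
    (FAll (FAll (FImp (fgraph G x.+2 y.+2 1) (FImp (fgraph G x.+2 y.+2 0) (feqv 1 0))))).
Definition ftotalise G x y w :=
  FOr (FAnd (fdetermined G x y) (fgraph G x y w))
    (FAnd (FNot (fdetermined G x y)) (feqv y w)).
Definition fdunion a b c :=
  FAnd (FAll (FIff (FMem 0 c.+1) (FOr (FMem 0 a.+1) (FMem 0 b.+1))))
    (FAll (FNot (FAnd (FMem 0 a.+1) (FMem 0 b.+1)))).
Definition fadd_graph z y w :=
  FOr (FEx (FEx (FEx (FAnd4 (fpr z.+3 2 2) (fpr y.+3 1 1) (fpr w.+3 0 0)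
        (FEx (FEx (FAnd3 (fequi 4 1) (fequi 3 0) (fdunion 1 0 2))))))))
    (FEx (FEx (FAnd4 (fpr z.+2 1 w.+2) (FNot (FEq 1 w.+2)) (fpr y.+2 0 0)
        (FAll (FImp (fpr w.+3 0 0) (fle 1 0)))))).
Definition fmul_graph x y w :=
  FEx (FEx (FEx (FAnd4 (fpr x.+3 2 2) (fpr y.+3 1 1) (fpr w.+3 0 0)
    (FAnd3
      (FAll (FImp (FMem 0 1) (FEx (FEx (FAnd3 (FMem 1 5) (FMem 0 4) (fpr 2 1 0))))))
      (FAll (FAll (FImp (FMem 1 4) (FImp (FMem 0 3) (FEx (FAnd (FMem 0 3) (fpr 0 2 1)))))))
      (FAll (FAll (FAll (FAll (FImp (FMem 3 4) (FImp (FMem 2 4)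
        (FImp (fpr 3 1 0) (FImp (fpr 2 1 0) (FEq 3 2))))))))))))).
Definition fadd := ftotalise fadd_graph.
Definition fmul := ftotalise fmul_graph.
Definition fempty a := FAll (FNot (FMem 0 a.+1)).
Definition fzero w := FEx (FAnd (fpr w.+1 0 0) (fempty 0)).
Definition fone y := FEx (FAnd (fpr y.+1 0 0) (FEx (FAll (FIff (FMem 0 2) (FEq 0 1))))).
Definition fsucc x w := FEx (FAnd (fone 0) (fadd x.+1 0 w.+1)).

End SetFormulas.

End RelationalFormulas.

Section SetFormulaSemantics.
Variables (R : countType) (ar : R -> nat) (m : R).
Variables (D : eqType) (rl : forall r, ('I_(ar r) -> D) -> Prop).
Local Notation mem := (mem_rel m rl).
Local Notation fsat := (fsat m rl).
Implicit Types e : nat -> D.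

Definition empty a := forall y, ~ mem y a.
Definition zero_number w := exists a, pr mem w a a /\ empty a.
Definition one_number y := exists a, pr mem y a a /\ exists u, forall v, mem v a <-> v = u.
Definition succ x w := exists y, one_number y /\ add mem x y w.

(** True by conversion, as are the next three; [FAnd3] and [FAnd4] exist so that conjunctions match
    the n-ary ones of the shallow definitions. *)
Lemma fsat_zero e w : fsat e (fzero R w) = zero_number (e w). Proof. by []. Qed.
Lemma fsat_succ e x w : fsat e (fsucc R x w) = succ (e x) (e w). Proof. by []. Qed.
Lemma fsat_add e x y w : fsat e (fadd R x y w) = add mem (e x) (e y) (e w). Proof. by []. Qed.
Lemma fsat_mul e x y w : fsat e (fmul R x y w) = mul mem (e x) (e y) (e w). Proof. by []. Qed.

End SetFormulaSemantics.

Lemma extend2_0 (T : Type) (z : 'I_2 -> T) x : extend z x 0 = z (@Ordinal 2 0 isT).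
Proof. exact: (extend_lt z x (isT : 0 < 2)). Qed.

Lemma extend2_1 (T : Type) (z : 'I_2 -> T) x : extend z x 1 = z (@Ordinal 2 1 isT).
Proof. exact: (extend_lt z x (isT : 1 < 2)). Qed.

Lemma extend1_0 (T : Type) (z : 'I_1 -> T) x : extend z x 0 = z (@Ordinal 1 0 isT).
Proof. exact: (extend_lt z x (isT : 0 < 1)). Qed.

Section StandardUnits.
Variables (R : countType) (ar : R -> nat) (m : R).
Variables (D : eqType) (rl : forall r, ('I_(ar r) -> D) -> Prop).
Local Notation mem := (mem_rel m rl).

Lemma zero_std w : zero_number m rl w <-> std mem 0 w.
Proof.
split=> -[a [wa h]]; exists a; split=> //.
  by exists [::]; split=> // y; split=> // /h.
by have [s [_ /size0nil -> sP]] := h => y /sP.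
Qed.

Lemma one_std y : one_number m rl y <-> std mem 1 y.
Proof.
split=> -[a [ya h]]; exists a; split=> //.
  by have [u uP] := h; exists [:: u]; split=> // v; rewrite uP inE; split=> /eqP.
by have [[|u [|v s]] [_ //= _ sP]] := h; exists u => y'; rewrite sP inE; split=> /eqP.
Qed.

End StandardUnits.

Section ArithmeticStructure.
Variable Q : struct sig_R.
Implicit Types (e : nat -> Q) (t u : term sig_R).

Definition addQ (x y : Q) : Q := @fi _ Q Add_R (fun j : 'I_2 => nth x [:: x; y] j).
Definition mulQ (x y : Q) : Q := @fi _ Q Mul_R (fun j : 'I_2 => nth x [:: x; y] j).

Lemma eval_addR e t u : eval e (addR t u) = addQ (eval e t) (eval e u).
Proof. by congr (@fi _ Q Add_R _); apply/funext => -[[|[|]]]. Qed.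

Lemma eval_mulR e t u : eval e (mulR t u) = mulQ (eval e t) (eval e u).
Proof. by congr (@fi _ Q Mul_R _); apply/funext => -[[|[|]]]. Qed.

Lemma sat_leR e t u : sat e (leR t u) = exists z, addQ z (eval e t) = eval e u.
Proof.
rewrite satEx; apply/propext; split=> -[z h]; exists z; move: h;
  by rewrite /sat eval_addR /shift !eval_subst.
Qed.

End ArithmeticStructure.

(** * The interpretation of R by finite sets *)

Section NumberTranslation.
Variables (L : signature) (K : translation sig_VS L).

Definition number_fct (f : fsym_R) : fo unit :=
  match f with
  | Zero_R => fzero _ 0
  | Succ_R => fsucc _ 0 1
  | Add_R => fadd _ 0 1 2
  | Mul_R => fmul _ 0 1 2
  end.

(** Every object counts as a number, whether or not it is a pair; those that are not pairs with
    equal components form classes of their own. *)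
Definition number_tr : translation sig_R L :=
  @Translation sig_R L (dim K) Top
    (tr K (@compile unit (fun=> 2) tt (feqv _ 0 1)))
    (fun f => tr K (@compile unit (fun=> 2) tt (number_fct f)))
    (fun r => match r with end).

Hypothesis wfK : translation_wf K.

Lemma number_wf : translation_wf number_tr.
Proof.
split.
- exact: (dim_gt0 wfK).
- by [].
- by apply: (@below_tr _ _ K wfK 2); apply: below_compile.
- by move=> f; apply: (@below_tr _ _ K wfK (far_R f).+1); apply: below_compile => //; case: f.
- by case.
Qed.

Variables (M : struct L) (x0 : M).
Local Notation XK := (tr_rstruct wfK x0).
Hypothesis domT : forall x : XK, rdom x.
Hypothesis eqnE : forall x y : XK, req x y = (x = y).
Local Notation D := {classic ('I_(dim K) -> M)}.
Definition vmem : D -> D -> Prop := mem_rel tt (@rrel _ XK).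
Hypothesis finset_ex : forall s : seq D, exists x, forall y, vmem y x <-> y \in s.
Local Notation X := (tr_rstruct number_wf x0).

Lemma flat_number (B : nat -> 'I_(dim K) -> M) :
  @flat _ _ number_tr M number_wf B = flat wfK B.
Proof. by apply/funext => v; congr (B _ _); apply: val_inj. Qed.

Lemma number_domT (x : X) : rdom x. Proof. by []. Qed.

Lemma number_req (x y : X) : req x y = eqv vmem x y.
Proof.
transitivity (sat (flat number_wf (sc x (fun=> y)))
  (tr K (@compile unit (fun=> 2) tt (feqv _ 0 1)))) => //.
by rewrite flat_number (sat_tr_direct domT eqnE) sat_compile.
Qed.

Lemma number_rfct f (z : 'I_(far_R f) -> X) (y : X) :
  @rfct _ X f z y =
    @fsat unit (fun=> 2) tt D (@rrel _ XK) (extend z y) (number_fct f).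
Proof.
transitivity (sat (flat number_wf (extend z y))
  (tr K (@compile unit (fun=> 2) tt (number_fct f)))) => //.
by rewrite flat_number (sat_tr_direct domT eqnE) sat_compile.
Qed.

(** For sums and products, totality and congruence were built into [totalise]. Zero and successor
    rely on numerals existing and being unique up to [eqv]. *)
Lemma number_good : good X.
Proof.
have fctE f (z : 'I_(far_R f) -> X) y := number_rfct z y.
split=> //.
- by exists (fun=> x0).
- by move=> x _; rewrite number_req.
- move=> x y z _ _ _; rewrite !number_req => xy xz.
  exact: eqv_trans (eqvC xy) xz.
- move=> f z _; suff [y zy] : exists y, @rfct _ X f z y by exists y; split.
  case: f z => z; last first.
  + have [w h] := totalise_ex vmem (mul_graph vmem) (z (@Ordinal 2 0 isT)) (z (@Ordinal 2 1 isT)).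
    by exists w; rewrite fctE [number_fct _]/= fsat_mul extend_out !extend2_0 !extend2_1.
  + have [w h] := totalise_ex vmem (add_graph vmem) (z (@Ordinal 2 0 isT)) (z (@Ordinal 2 1 isT)).
    by exists w; rewrite fctE [number_fct _]/= fsat_add extend_out !extend2_0 !extend2_1.
  + have [p p1] := std_ex finset_ex 1.
    have [w h] := totalise_ex vmem (add_graph vmem) (z (@Ordinal 1 0 isT)) p.
    exists w; rewrite fctE [number_fct _]/= fsat_succ extend_out extend1_0; exists p.
    by split=> //; apply/one_std.
  + have [p p0] := std_ex finset_ex 0.
    by exists p; rewrite fctE [number_fct _]/= fsat_zero extend_out; apply/zero_std.
- move=> f z z' y y' _ _ _ _ zz'; rewrite number_req !fctE.
  have {}zz' j : eqv vmem (z j) (z' j) by rewrite -number_req.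
  case: f z z' zz' => z z' zz'.
  + rewrite ![number_fct _]/= !fsat_zero !extend_out => /zero_std y0 /zero_std y0'.
    exact/(std_eqv finset_ex _ y0).
  + rewrite ![number_fct _]/= !fsat_succ !extend_out !extend1_0.
    move=> -[u [/one_std u1 h]] [u' [/one_std u1' h']].
    by apply: totalise_fun h h' => //; apply/(std_eqv finset_ex _ u1).
  + by rewrite ![number_fct _]/= !fsat_add !extend_out !extend2_0 !extend2_1; apply: totalise_fun.
  + by rewrite ![number_fct _]/= !fsat_mul !extend_out !extend2_0 !extend2_1; apply: totalise_fun.
Qed.

Variables (Q : struct sig_R) (q : X -> Q).
Hypothesis qX : quotient q.

Lemma number_quo_eq (x y : X) : (q x = q y) = eqv vmem x y.
Proof. by rewrite (quo_eq qX) ?number_req. Qed.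

Lemma number_quo_std n (p : X) : std vmem n p -> q p = numQ Q n.
Proof.
elim: n p => [|n IH] p pn.
  have h : @rfct _ X Zero_R (@elim0 X) p.
    by rewrite number_rfct [number_fct _]/= fsat_zero extend_out; apply/zero_std.
  rewrite -(quo_fct qX (fun j => @number_domT _) (@number_domT p) h).
  by congr fi; apply: elim0E.
have [p' pn'] := std_ex finset_ex n; rewrite /= -(IH p' pn').
have [o o1] := std_ex finset_ex 1.
have [w h] := totalise_ex vmem (add_graph vmem) p' o.
have wn := add_std finset_ex pn' o1 h; rewrite addn1 in wn.
have -> : q p = q w by rewrite number_quo_eq; apply/(std_eqv finset_ex _ pn).
have h' : @rfct _ X Succ_R (fun=> p') w.
  rewrite number_rfct [number_fct _]/= fsat_succ extend_out extend1_0.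
  by exists o; split=> //; apply/one_std.
by rewrite -(quo_fct qX (fun j => @number_domT _) (@number_domT w) h').
Qed.

Lemma number_quo_numQ n (p : X) : (q p = numQ Q n) = std vmem n p.
Proof.
have [p' pn'] := std_ex finset_ex n; rewrite -(number_quo_std pn') number_quo_eq.
apply/propext; split=> [/eqvC h|pn]; first exact/(std_eqv finset_ex _ pn').
exact/(std_eqv finset_ex _ pn).
Qed.

Lemma number_quo_add (x y w : X) : add vmem x y w -> addQ (q x) (q y) = q w.
Proof.
move=> h; have h' : @rfct _ X Add_R (fun j : 'I_2 => nth x [:: x; y] j) w.
  by rewrite number_rfct [number_fct _]/= fsat_add extend_out !extend2_0 !extend2_1.
rewrite -(quo_fct qX (fun j => @number_domT _) (@number_domT w) h').
by congr fi; apply/funext => -[[|[|]]].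
Qed.

Lemma number_quo_mul (x y w : X) : mul vmem x y w -> mulQ (q x) (q y) = q w.
Proof.
move=> h; have h' : @rfct _ X Mul_R (fun j : 'I_2 => nth x [:: x; y] j) w.
  by rewrite number_rfct [number_fct _]/= fsat_mul extend_out !extend2_0 !extend2_1.
rewrite -(quo_fct qX (fun j => @number_domT _) (@number_domT w) h').
by congr fi; apply/funext => -[[|[|]]].
Qed.

(** The first three axioms speak of numerals, where all values have been computed. [add_bounded] and
    [add_total] are made for the two axioms on the order. *)
Lemma number_models : models Q TheoryR.
Proof.
have std_num n : exists2 p, std vmem n p & numQ Q n = q p.
  by have [p pn] := std_ex finset_ex n; exists p; rewrite ?(number_quo_std pn).
move=> _ [m n|m n|m n mn|n|n] e.
- rewrite /sat eval_addR !eval_numR; have [x xm ->] := std_num m; have [y yn ->] := std_num n.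
  have [w h] := totalise_ex vmem (add_graph vmem) x y; rewrite (number_quo_add h).
  exact/number_quo_std/(add_std finset_ex xm yn h).
- rewrite /sat eval_mulR !eval_numR; have [x xm ->] := std_num m; have [y yn ->] := std_num n.
  have [w h] := totalise_ex vmem (mul_graph vmem) x y; rewrite (number_quo_mul h).
  exact/number_quo_std/(mul_std finset_ex xm yn h).
- rewrite satNot /sat !eval_numR; have [x xm ->] := std_num m.
  by rewrite number_quo_numQ => /(std_inj xm) h; rewrite h eqxx in mn.
- rewrite satAll => c; rewrite satImp sat_leR eval_numR => -[z].
  have [x _ <-] := quo_surj qX c; have [z' _ <-] := quo_surj qX z; rewrite [eval _ _]/=.
  have [w h] := totalise_ex vmem (add_graph vmem) z' x; rewrite (number_quo_add h) number_quo_numQ.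
  move=> wn; have [k kn xk] := add_bounded finset_ex wn h.
  rewrite sat_bigOr; exists (Ordinal (kn : k < n.+1)).
  by rewrite /sat eval_numR /=; apply: number_quo_std.
- rewrite satAll => c; rewrite satOr !sat_leR eval_numR /=.
  have [x _ <-] := quo_surj qX c; have [y yn yE] := std_num n.
  have [[z [w [wn h]]]|[z [w [wx h]]]] := add_total finset_ex x yn; [left|right].
    by exists (q z); rewrite (number_quo_add h) (number_quo_std wn).
  by exists (q z); rewrite yE (number_quo_add h) number_quo_eq.
Qed.

End NumberTranslation.

(** * Transfer of truth predicates *)

Section Certificates.
Variables (D : eqType) (mem : D -> D -> Prop).
Hypothesis finset_ex : forall s : seq D, exists x, forall y, mem y x <-> y \in s.

(** A shallow form of n~, with [Z] and [S] for its two kinds of atoms. *)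
Fixpoint chain (T : Type) (Z : T -> Prop) (S : T -> T -> Prop) (n : nat) (x : T) : Prop :=
  if n is n'.+1 then exists u, chain Z S n' u /\ S u x else Z x.

Variables (Z : D -> Prop) (S : D -> D -> Prop).

Definition adjoined a' a := exists u, ~ mem u a' /\ forall y, mem y a <-> mem y a' \/ y = u.

(* When [y] is the numeral n, this says that [g] is the end of a chain of length n:
   the finite sets [a] counting the steps rule out cycles and infinite descent. *)
Definition certified g y := exists a f, [/\ pr mem y a a, app mem f g a
  & forall g0 a0, app mem f g0 a0 -> Z g0 /\ (forall u, ~ mem u a0) \/
      exists g' a', [/\ app mem f g' a', S g' g0 & adjoined a' a0]].

(** From a certificate, the chain is read off downwards: a nonempty counting set excludes the
    initial case, and the predecessor comes with a set that has one element less. Conversely, the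
    members of a chain are paired with sets of decreasing size, and these finitely many pairs make
    up [f]. *)
Lemma certified_chain n g y : std mem n y -> certified g y <-> chain Z S n g.
Proof.
move=> [a [ya an]]; split=> [[a1 [f [/(pr_inj ya)[<- _] fga h]]]|gn].
  elim: n a g an fga {y ya} => [|n IH] a g [s [us sn sP]] /h.
    move=> [[] //|[g' [a' [_ _ [u [_ uP]]]]]].
    by have /sP := (uP u).2 (or_intror erefl); rewrite (size0nil sn).
  move=> [[_ a0]|[g' [a' [fg' g'g [u [ua' uP]]]]]].
    by case: s sn sP {us} => // u s _ sP; case: (a0 u); apply/sP; rewrite inE eqxx.
  exists g'; split=> //; apply: IH fg'; exists (rem u s).
  have us' : u \in s by apply/sP/uP; right.
  split; first exact: rem_uniq; first by rewrite size_rem // sn.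
  move=> v; rewrite mem_rem_uniq // !inE; split=> [va'|/andP[/eqP vu /sP/uP[]//]].
  apply/andP; split; first by apply/eqP => vu; rewrite vu in va'.
  by apply/sP/uP; left.
have [l [gl lP]] : exists l : seq (D * D), (g, a) \in l /\ forall g0 a0, (g0, a0) \in l ->
    Z g0 /\ (forall u, ~ mem u a0) \/
    exists g' a', [/\ (g', a') \in l, S g' g0 & adjoined a' a0].
  elim: n a g an gn {y ya} => [|n IH] a g [s [us sn sP]] /=.
    move=> gZ; exists [:: (g, a)]; rewrite inE; split=> // g0 a0; rewrite inE => /eqP[-> ->].
    by left; split=> // u /sP; rewrite (size0nil sn).
  move=> [g' [g'n g'g]]; case: s us sn sP => // u s /= /andP[us us'] [sn] sP.
  have [a' a'P] := finset_ex s.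
  have [|l [gl lP]] := IH a' g' _ g'n; first by exists s.
  exists ((g, a) :: l); split; first by rewrite inE eqxx.
  move=> g0 a0; rewrite inE => /predU1P[[-> ->]|/lP[|[g1 [a1 [gl1 gg1 aa1]]]]].
  - right; exists g', a'; split=> //; first by rewrite inE gl orbT.
    exists u; split=> [/a'P|v]; first by rewrite (negbTE us).
    by rewrite sP a'P inE; split=> [/predU1P[]|[->|->]]; rewrite ?eqxx ?orbT; auto.
  - by left.
  - by right; exists g1, a1; rewrite inE gl1 orbT.
have [f fP] := graph_ex finset_ex l; exists a, f; split=> //; first exact/fP.
move=> g0 a0 /fP/lP[|[g' [a' [gl' gg' aa']]]]; first by left.
by right; exists g', a'; split=> //; apply/fP.
Qed.

(** Nested pairs with the last component outermost, ending in an arbitrary object: a tuple has many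
    codes, but a code determines the tuple. *)
Fixpoint coded (k : nat) (g : D) (x : nat -> D) : Prop :=
  if k is k'.+1 then exists q, pr mem g (x k') q /\ coded k' q x else True.

Lemma coded_ext k g x x' : (forall i, i < k -> x i = x' i) -> coded k g x -> coded k g x'.
Proof.
elim: k g => [//|k IH] g xx' [q [gq qx]]; exists q; split; first by rewrite -xx'.
by apply: IH qx => i ik; apply/xx'/ltnW.
Qed.

Lemma coded_ex k x : exists g, coded k g x.
Proof.
elim: k => [|k [q qx]]; first by exists (x 0).
by have [g gq] := pr_ex finset_ex (x k) q; exists g, q.
Qed.

Lemma coded_inj k g x x' : coded k g x -> coded k g x' -> forall i, i < k -> x i = x' i.
Proof.
elim: k g => [//|k IH] g [q [gq qx]] [q' [/(pr_inj gq)[xk <-] qx']] i.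
by rewrite ltnS leq_eqVlt => /predU1P[->//|/(IH q qx qx')].
Qed.

End Certificates.

(** Certificates relate single objects, while the elements of an interpretation may be tuples. As
    every tuple has a code and no code belongs to two tuples, chains of codes amount to chains of
    tuples. *)
Lemma chain_code (D E : Type) (C : D -> E -> Prop) (Z : E -> Prop) (S : E -> E -> Prop) n g :
  (forall x, exists g, C g x) -> (forall g x x', C g x -> C g x' -> x = x') ->
  chain (fun g => exists x, C g x /\ Z x)
    (fun g' g => exists x' x, [/\ C g' x', C g x & S x' x]) n g <->
  exists x, C g x /\ chain Z S n x.
Proof.
move=> Ctot Cinj; elim: n g => [//|n IH] g /=; split.
  move=> [g' [/IH[x [gx xn]] [x' [y [gx' gy xy]]]]].
  by exists y; split=> //; exists x'; split=> //; rewrite (Cinj _ _ _ gx' gx).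
move=> [x [gx [u [un ux]]]]; have [g' gu] := Ctot u.
by exists g'; split; [apply/IH; exists u|exists u, x].
Qed.

Section Reduct.
Variables (L : signature) (N : translation sig_Succ0 L).

Definition reduct (W : struct (sig_T N)) : struct L :=
  @Struct L W (fun f z => @fi (sig_T N) W f z) (fun r z => @ri (sig_T N) W (Some r) z).

Lemma sat_emb (W : struct (sig_T N)) (e : nat -> W) (phi : form L) :
  sat e (emb N phi) = @sat _ (reduct W) e phi.
Proof.
have evalE (e' : nat -> W) t : eval e' (emb_term N t) = @eval _ (reduct W) e' t.
  by elim: t => //= f ts IH; congr fi; apply/funext => j; apply: IH.
elim: phi e => [|t u|r ts|phi IH1 psi IH2|phi IH] e //=.
- by rewrite !evalE.
- by congr ri; apply/funext => j; apply: evalE.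
- by rewrite IH1 IH2.
- by apply/propext; split=> h x; have := h x; rewrite IH.
Qed.

Lemma below_emb k (phi : form L) : below k phi -> below k (emb N phi).
Proof.
have tb t m : term_below m t -> term_below m (emb_term N t).
  by elim: t => //= f ts IH /forallP h; apply/forallP => j; apply: IH.
elim: phi k => //= [t u|r ts|phi IH1 psi IH2|phi IH] k.
- by case/andP=> *; rewrite !tb.
- by move=> /forallP h; apply/forallP => j; apply: tb.
- by case/andP=> *; rewrite IH1 ?IH2.
- exact: IH.
Qed.

End Reduct.

Section Witness.
Variables (L : signature) (U : set (form L)) (K : translation sig_VS L).
Hypotheses (intK : interpretation K VS U) (dirK : direct K U).
Let wfK : translation_wf K := intK.1.
Variables (M : struct L) (x0 : M).
Hypothesis MU : models M U.
Local Notation XK := (tr_rstruct wfK x0).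

Let sat_closed k (phi : form L) (e : nat -> M) : below k phi -> prv U (alls k phi) -> sat e phi.
Proof.
move=> phik /soundness/(_ e (fun psi Upsi => MU Upsi e)); rewrite sat_alls => /(_ e).
by rewrite (sat_below (e' := e) _ phik) // => i ->.
Qed.

Lemma witness_domT (x : XK) : rdom x.
Proof. by apply: sat_closed dirK.1; case: wfK. Qed.

Lemma witness_eqnE (x y : XK) : req x y = (x = y).
Proof.
have := sat_closed (flat wfK (sc x (fun=> y))) _ dirK.2.
rewrite satIff (sat_eq_blocks wfK) /= => h; apply/propext; apply: h.
have eqn_b : below (2 * dim K) (eqn K) by case: wfK.
by rewrite /= eqn_b below_eq_blocks.
Qed.

(** The parameters of the axiom are set to the entries of [s]. Directness turns its equality into
    identity and lets its quantifiers range over all tuples. *)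
Lemma witness_finset (s : seq {classic ('I_(dim K) -> M)}) :
  exists x, forall y, vmem wfK x0 y x <-> y \in s.
Proof.
pose phi : form sig_VS := alls (size s) (Ex (All (Iff (Mem (Var 0) (Var 1))
  (\big[@Or _/Fal]_(i < size s) Eq (Var 0) (Var i.+2))))).
have phi_sent : sentence phi.
  rewrite /sentence /= below_alls /= !andbT addn0.
  rewrite (@below_bigOr _ _ _ (fun i : 'I_(size s) => Eq (Var 0) (Var i.+2))).
    by rewrite andbT; apply/andP; split; apply/forallP => -[[|[|]]].
  by move=> i; rewrite /= !ltnS.
have := soundness (intK.2 phi phi_sent (prv_ax (VS_set _))).
pose b0 : {classic ('I_(dim K) -> M)} := fun=> x0.
move=> /(_ _ (flat wfK (fun=> b0)) (fun psi Upsi => MU Upsi _)).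
rewrite (sat_tr_direct witness_domT witness_eqnE) sat_alls.
move=> /(_ (nth b0 s)); rewrite satEx => -[x]; rewrite satAll => h; exists x => y.
have := h y; rewrite satIff sat_bigOr.
have -> : Mem (Var 0) (Var 1) = @compile unit (fun=> 2) tt (FMem _ 0 1) by [].
rewrite sat_compile // => {}h.
apply: (iff_trans h); split=> [[i /= ->]|/(nthP b0)[i ilt <-]].
  by rewrite ltn_ord mem_nth.
by exists (Ordinal ilt); rewrite /= ilt.
Qed.

End Witness.

Lemma interpretation_number (L : signature) (U : set (form L)) (K : translation sig_VS L) :
  U `<=` @sentence L -> Vaught_witness U K -> interpretation (number_tr K) TheoryR U.
Proof.
move=> Usent [intK dirK].
apply: (interpretation_intro Usent (wf := number_wf intK.1)) => M x0 MU.
have domT := @witness_domT _ _ _ intK dirK M x0 MU.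
have eqnE := @witness_eqnE _ _ _ intK dirK M x0 MU.
have finset_ex := @witness_finset _ _ _ intK dirK M x0 MU.
have g := number_good domT eqnE finset_ex.
split=> //; have [Q [q qQ]] := quotient_exists g; exists Q, q; split=> //.
exact: (number_models domT eqnE finset_ex qQ).
Qed.

(** * The truth formula over coded tuples *)

Local Notation natC := (nat : countType).

Section CodeFormulas.
Variable k : nat.

(** Symbol 0 is membership, 1 is being zero in N, 2 is the successor relation of N on two k-tuples,
    and 3 is T. *)
Definition code_ar (r : natC) : nat := match r with 0 => 2 | 2 => k + k | _ => k end.
Definition sig_code : signature := @Signature void natC (fun=> 0) code_ar.
(** The components of the tuple are the consecutive variables from [o] on. The base case is a
    trivially true equation. *)
Fixpoint fcoded (n g o : nat) : fo natC :=
  if n is n'.+1 then FEx (FAnd (fpr natC g.+1 (o + n').+1 0) (fcoded n' 0 o.+1)) else FEq natC 0 0.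

Definition fexs n (phi : fo natC) : fo natC := iter n (@FEx natC) phi.

(** The bound tuple occupies the variables below k, so the outer variable g becomes k + g; in
    [fstep] two tuples are bound and the offset is k + k. *)
Definition fstart g := fexs k (FAnd (fcoded k (k + g) 0) (@FRel natC 1 (iota 0 k))).
Definition fstep g' g := fexs (k + k)
  (FAnd3 (fcoded k (k + k + g') 0) (fcoded k (k + k + g) k) (@FRel natC 2 (iota 0 (k + k)))).
Definition ftrue g := fexs k (FAnd (fcoded k (k + g) 0) (@FRel natC 3 (iota 0 k))).
Definition fadjoined a' a := FEx (FAnd (FNot (FMem natC 0 a'.+1))
  (FAll (FIff (FMem natC 0 a.+2) (FOr (FMem natC 0 a'.+2) (FEq natC 0 1))))).
Definition fcertified g y :=
  FEx (FEx (FAnd3 (fpr natC y.+2 1 1) (fapp natC 0 g.+2 1)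
    (FAll (FAll (FImp (fapp natC 2 1 0) (FOr (FAnd (fstart 1) (fempty natC 0))
      (FEx (FEx (FAnd3 (fapp natC 4 1 0) (fstep 1 3) (fadjoined 0 2)))))))))).
Definition ftruth : fo natC := FEx (FAnd (fcertified 0 1) (ftrue 0)).

Lemma fbelow_exs m n phi : fbelow code_ar m (fexs n phi) = fbelow code_ar (n + m) phi.
Proof. by elim: n m => //= n IH m; rewrite IH addnS. Qed.

Lemma fbelow_coded m n g o : g < m -> o + n <= m -> 0 < m -> fbelow code_ar m (fcoded n g o).
Proof.
have prb m' p a b : p < m' -> a < m' -> b < m' -> fbelow code_ar m' (fpr natC p a b).
  by move=> pm am bm; apply/and3P; split; rewrite /= ?andbT; repeat (apply/andP; split).
elim: n m g o => [|n IH] m g o gm om m0; first by rewrite /= m0.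
have on : o + n < m by rewrite -addnS.
change (fbelow code_ar m.+1 (fpr natC g.+1 (o + n).+1 0) &&
  fbelow code_ar m.+1 (fcoded n 0 o.+1)).
by rewrite prb // IH // addSn ltnS ltnW.
Qed.

Lemma fbelow_rel m r : code_ar r <= m -> fbelow code_ar m (@FRel natC r (iota 0 (code_ar r))).
Proof.
move=> rm /=; apply/allP => i; rewrite mem_iota add0n => /= ir.
by rewrite nth_iota // add0n; apply: leq_trans rm.
Qed.

Lemma fbelow_truth : fbelow code_ar 1 ftruth.
Proof.
have band m phi psi : fbelow code_ar m phi -> fbelow code_ar m psi ->
  fbelow code_ar m (FAnd phi psi) by move=> /= -> ->.
have band3 m phi psi chi : fbelow code_ar m phi -> fbelow code_ar m psi ->
  fbelow code_ar m chi -> fbelow code_ar m (FAnd3 phi psi chi) by move=> /= -> -> ->.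
have start m g : g < m -> fbelow code_ar m (fstart g).
  move=> gm; rewrite /fstart fbelow_exs; apply: band; last first.
    by apply: (fbelow_rel (r := 1)); rewrite leq_addr.
  by apply: fbelow_coded; rewrite ?ltn_add2l ?leq_addr // addn_gt0 (leq_ltn_trans _ gm) ?orbT.
have tru m g : g < m -> fbelow code_ar m (ftrue g).
  move=> gm; rewrite /ftrue fbelow_exs; apply: band; last first.
    by apply: (fbelow_rel (r := 3)); rewrite leq_addr.
  by apply: fbelow_coded; rewrite ?ltn_add2l ?leq_addr // addn_gt0 (leq_ltn_trans _ gm) ?orbT.
have stp m g' g : g < m -> g' < m -> fbelow code_ar m (fstep g' g).
  move=> gm g'm; have m0 : 0 < k + k + m by rewrite addn_gt0 (leq_ltn_trans _ gm) ?orbT.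
  rewrite /fstep fbelow_exs; apply: band3; last by apply: (fbelow_rel (r := 2)); rewrite leq_addr.
    by apply: fbelow_coded; rewrite ?ltn_add2l // add0n -addnA leq_addr.
  by apply: fbelow_coded; rewrite ?ltn_add2l // leq_addr.
(* The bounds 2, 8 and 6 count the variables in scope where these subformulas occur in [ftruth];
   once they are generalised, the rest is decided by computation. *)
have := tru 2 0 isT; have := stp 8 1 3 isT isT; have := start 6 1 isT.
rewrite /ftruth /fcertified.
by move: (fstart 1) (fstep 1 3) (ftrue 0) => a b c; rewrite /= => -> -> ->.
Qed.

End CodeFormulas.

Section CodeSemantics.
Variables (L : signature) (N : translation sig_Succ0 L) (K : translation sig_VS L).
Local Notation k := (dim N).
Hypotheses (wfN : translation_wf N) (wfK : translation_wf K).

(* A [k]-tuple of elements is read off the first components of [k] sets. *)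
Definition heads (phi : form (sig_T N)) : form (sig_T N) :=
  rename (fun v => v * dim K) phi.

(** Domain and equality are those of [K], so the translation is direct when [K] is. The further
    symbols carry over zero, successor and T of [N], whose dimension may differ from that of [K]. *)
Definition code_tr : translation (sig_code k) (sig_T N) :=
  @Translation (sig_code k) (sig_T N) (dim K) (emb N (dom K)) (emb N (eqn K))
    (fun f => match f with end)
    (fun r => match r with
      | 0 => emb N (rel K tt)
      | 1 => heads (emb N (And (dom N) (tr N (Eq (Var 0) zero0))))
      | 2 => heads (emb N (And (And (dom N) (rename_blocks N (fun=> 1) (dom N)))
                              (tr N (S0 (Var 0) (Var 1)))))
      | _ => heads (@Rel (sig_T N) None (fun c => Var c))
      end).

Lemma below_heads n phi : below n phi -> below (n * dim K) (heads phi).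
Proof. by apply: below_subst => v /=; rewrite ltn_mul2r (dim_gt0 wfK). Qed.

Lemma code_wf : translation_wf code_tr.
Proof.
have [d0 dom_b eqn_b _ rel_b] := wfK; have [_ domN_b _ _ _] := wfN.
split; [exact: d0|exact: below_emb|exact: below_emb|by case|].
have zero_b : below k (tr N (Eq (Var 0) zero0)).
  have := @below_tr _ _ N wfN 1 (Eq (Var 0) zero0); rewrite mul1n; apply.
  by rewrite /=; apply/forallP => j; case: (elim0 False j).
have succ_b : below (k + k) (tr N (S0 (Var 0) (Var 1))).
  have := @below_tr _ _ N wfN 2 (S0 (Var 0) (Var 1)); rewrite mul2n -addnn; apply.
  by apply/forallP => -[[|[|]]].
have dom1_b : below (k + k) (rename_blocks N (fun=> 1) (dom N)).
  have := @below_rename_blocks _ _ N wfN (fun=> 1) 1 2 (dom N); rewrite mul1n mul2n -addnn.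
  by apply.
have true_b : below k (@Rel (sig_T N) None (fun c => Var c)) by apply/forallP => c /=.
case=> [|[|[|r]]].
- exact: below_emb (rel_b tt).
- by apply/below_heads/below_emb; rewrite /= domN_b zero_b.
- apply/below_heads/below_emb; rewrite /= dom1_b succ_b !andbT.
  by apply: below_le domN_b; apply: leq_addr.
- exact: below_heads.
Qed.

Variables (W : struct (sig_T N)) (x0 : W).
Local Notation M := (reduct W).
Local Notation XK := (@tr_rstruct _ _ K M wfK x0).
Local Notation XC := (tr_rstruct code_wf x0).
Local Notation XN := (@tr_rstruct _ _ N M wfN x0).
Local Notation D := {classic ('I_(dim K) -> W)}.
Hypothesis domT : forall x : XK, rdom x.
Hypothesis eqnE : forall x y : XK, req x y = (x = y).
Local Notation vmem := (@vmem L K wfK M x0).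
Hypothesis finset_ex : forall s : seq D, exists x, forall y, vmem y x <-> y \in s.

Lemma flat_code (B : nat -> 'I_(dim K) -> W) :
  @flat _ _ code_tr W code_wf B = @flat _ _ K M wfK B.
Proof. by apply/funext => v; congr (B _ _); apply: val_inj. Qed.

Lemma code_domT (x : XC) : rdom x.
Proof.
change (sat (flat code_wf (fun=> x)) (emb N (dom K))).
by rewrite flat_code sat_emb; apply: domT.
Qed.

Lemma code_eqnE (x y : XC) : req x y = (x = y).
Proof.
rewrite -eqnE; change (sat (flat code_wf (sc x (fun=> y))) (emb N (eqn K)) = @req _ XK x y).
by rewrite flat_code sat_emb.
Qed.

Local Notation rl := (@rrel _ XC).

Lemma code_mem : @mem_rel natC (code_ar k) 0 D rl = vmem.
Proof.
apply/funext => x; apply/funext => y.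
change (sat (flat code_wf (extend (fun j : 'I_2 => nth x [:: x; y] j) (fun=> x0)))
  (emb N (rel K tt)) = vmem x y).
by rewrite flat_code sat_emb.
Qed.

Definition head (x : 'I_(dim K) -> W) : W := x (Ordinal (dim_gt0 wfK)).

Lemma sat_heads (B : nat -> 'I_(dim K) -> W) phi :
  sat (flat code_wf B) (heads phi) = sat (fun v => head (B v)) phi.
Proof.
rewrite /heads sat_rename; congr sat; apply/funext => v; rewrite flat_code.
by rewrite -[v * dim K]addn0 (@flatE _ _ K M wfK B v (Ordinal (dim_gt0 wfK))).
Qed.

(** The domain conditions are included here and in [step_rel], so that a chain stays in the domain
    of [N] by itself. *)
Definition start_rel (x : XN) : Prop := rdom x /\ rsat (fun=> x) (Eq (Var 0) zero0).
Definition step_rel (u x : XN) : Prop :=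
  (rdom u /\ rdom x) /\ rsat (sc u (fun=> x)) (S0 (Var 0) (Var 1)).
Definition true_rel (x : XN) : Prop := @ri (sig_T N) W None x.

Lemma sat_dom (e : nat -> M) : sat e (dom N) = @rdom _ XN (fun c => e c).
Proof.
have [_ domN_b _ _ _] := wfN; rewrite -{1}(blocksK wfN e).
apply: sat_below domN_b => v vk.
by apply: (flat_below _ (n := 1)) => [[]//|]; rewrite mul1n.
Qed.

Lemma code_start (z : 'I_k -> D) : rl (r := 1) z = start_rel (fun c => head (z c)).
Proof.
change (sat (flat code_wf (extend z (fun=> x0)))
  (heads (emb N (And (dom N) (tr N (Eq (Var 0) zero0))))) = start_rel (fun c => head (z c))).
set e := fun v => head (extend z (fun=> x0) v).
have eE : (fun c : 'I_k => e c) = fun c => head (z c).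
  by apply/funext => c; rewrite /e extend_ord.
rewrite sat_heads sat_emb satAnd sat_dom -/e eE /start_rel; congr (_ /\ _).
rewrite -[e](@blocksK _ _ N M wfN) (sat_tr wfN (x0 : M)).
apply: (@rsat_below _ _ 1) => [[]//|].
by rewrite /=; apply/forallP => j; case: (elim0 False j).
Qed.

Lemma code_step (z : 'I_(k + k) -> D) : rl (r := 2) z =
  step_rel (fun c => head (z (lshift k c))) (fun c => head (z (rshift k c))).
Proof.
change (sat (flat code_wf (extend z (fun=> x0)))
  (heads (emb N (And (And (dom N) (rename_blocks N (fun=> 1) (dom N)))
    (tr N (S0 (Var 0) (Var 1)))))) =
  step_rel (fun c => head (z (lshift k c))) (fun c => head (z (rshift k c)))).
set e := fun v => head (extend z (fun=> x0) v).
have el : (fun c : 'I_k => e c) = fun c => head (z (lshift k c)).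
  by apply/funext => c; rewrite /e (extend_ord z _ (lshift k c)).
have er : @blocks _ _ N M e 1 = fun c => head (z (rshift k c)).
  by apply/funext => c; rewrite /blocks mul1n /e (extend_ord z _ (rshift k c)).
rewrite sat_heads sat_emb satAnd satAnd sat_dom -/e el /step_rel.
congr ((_ /\ _) /\ _).
- by rewrite -[e](@blocksK _ _ N M wfN) sat_rename_blocks /= -er.
- rewrite -[e](@blocksK _ _ N M wfN) (sat_tr wfN (x0 : M)).
  apply: (@rsat_below _ _ 2) => [[//|[_|//]]|]; first exact: er.
  by apply/forallP => -[[|[|]]].
Qed.

Lemma code_true (z : 'I_k -> D) : rl (r := 3) z = true_rel (fun c => head (z c)).
Proof.
change (sat (flat code_wf (extend z (fun=> x0))) (heads (@Rel (sig_T N) None (fun c => Var c)))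
  = true_rel (fun c => head (z c))).
rewrite sat_heads /=; congr (ri _); apply/funext => c.
by rewrite extend_ord.
Qed.

Local Notation fsat := (@fsat natC (code_ar k) 0 D rl).

Lemma fsat_exs n (e : nat -> D) phi : fsat e (fexs n phi) <->
  exists x : nat -> D, fsat (fun i => if i < n then x i else e (i - n)) phi.
Proof.
rewrite -sat_compile //.
have -> : compile (code_ar k) 0 (fexs n phi) = exs n (compile (code_ar k) 0 phi).
  by elim: n => //= n ->.
by rewrite sat_exs; split=> -[x h]; exists x; move: h; rewrite sat_compile.
Qed.

Lemma fsat_coded n (e : nat -> D) g o :
  fsat e (fcoded n g o) <-> coded vmem n (e g) (fun i => e (o + i)).
Proof.
elim: n e g o => [//|n IH] e g o; split=> -[q [gq qn]]; exists q; split.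
- by move: gq; rewrite -code_mem.
- exact: (IH (sc q e) 0 o.+1).1 qn.
- by rewrite -code_mem in gq.
- exact: (IH (sc q e) 0 o.+1).2 qn.
Qed.

(** A k-tuple of elements first becomes k objects that have these elements as heads, and then one
    object by nested pairing; this bridges the dimensions of [N] and [K]. *)
Definition encodes (g : D) (x : XN) : Prop :=
  exists y : nat -> D, coded vmem k g y /\ (fun c : 'I_k => head (y c)) = x.

Lemma encodes_ex x : exists g, encodes g x.
Proof.
(* An element is turned into an object by repeating it in all components. *)
pose y : nat -> D := extend (fun c : 'I_k => (fun=> x c) : D) (fun=> x0).
have [g gy] := coded_ex finset_ex k y; exists g, y; split=> //.
by apply/funext => c; rewrite /y extend_ord.
Qed.

Lemma encodes_inj g x x' : encodes g x -> encodes g x' -> x = x'.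
Proof.
move=> [y [gy <-]] [y' [gy' <-]]; apply/funext => c.
by rewrite (coded_inj gy gy' (ltn_ord c)).
Qed.

Definition start_code g := exists x, encodes g x /\ start_rel x.
Definition step_code g' g := exists x' x, [/\ encodes g' x', encodes g x & step_rel x' x].
Definition true_code g := exists x, encodes g x /\ true_rel x.

Let rel_iota r (z : nat -> D) (e : nat -> D) :
  rl (r := r) (fun c : 'I_(code_ar k r) =>
    (fun i => if i < code_ar k r then z i else e (i - code_ar k r))
    (nth 0 (iota 0 (code_ar k r)) c)) = rl (r := r) (fun c => z c).
Proof.
by congr (rl _); apply/funext => c; rewrite nth_iota // add0n ltn_ord.
Qed.

Lemma fsat_start (e : nat -> D) g : fsat e (fstart k g) <-> start_code (e g).
Proof.
rewrite fsat_exs; split=> [[x [h1 h2]]|[_ [[y [gy <-]] h]]].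
  exists (fun c => head (x c)); split; last by rewrite -code_start -(rel_iota 1 x e).
  exists x; split=> //; have := (fsat_coded k _ (k + g) 0).1 h1; rewrite ltnNge leq_addr addKn.
  by apply: coded_ext => i ik; rewrite ik.
exists y; split; last by rewrite -code_start -(rel_iota 1 y e) in h.
apply: (fsat_coded k _ (k + g) 0).2.
by rewrite ltnNge leq_addr addKn; apply: coded_ext gy => i ik; rewrite ik.
Qed.

Lemma fsat_true (e : nat -> D) g : fsat e (ftrue k g) <-> true_code (e g).
Proof.
rewrite fsat_exs; split=> [[x [h1 h2]]|[_ [[y [gy <-]] h]]].
  exists (fun c => head (x c)); split; last by rewrite -code_true -(rel_iota 3 x e).
  exists x; split=> //; have := (fsat_coded k _ (k + g) 0).1 h1; rewrite ltnNge leq_addr addKn.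
  by apply: coded_ext => i ik; rewrite ik.
exists y; split; last by rewrite -code_true -(rel_iota 3 y e) in h.
apply: (fsat_coded k _ (k + g) 0).2.
by rewrite ltnNge leq_addr addKn; apply: coded_ext gy => i ik; rewrite ik.
Qed.

Lemma fsat_step (e : nat -> D) g' g : fsat e (fstep k g' g) <-> step_code (e g') (e g).
Proof.
rewrite fsat_exs; split=> [[x [h1 h2 h3]]|[_ [_ [[y' [gy' <-]] [y [gy <-]] h]]]].
  pose y i := x (k + i).
  exists (fun c => head (x c)), (fun c => head (y c)); split.
  - exists x; split=> //; have := (fsat_coded k _ (k + k + g') 0).1 h1.
    by rewrite ltnNge leq_addr addKn; apply: coded_ext => i ik; rewrite ltn_addr.
  - exists y; split=> //; have := (fsat_coded k _ (k + k + g) k).1 h2.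
    by rewrite ltnNge leq_addr addKn; apply: coded_ext => i ik; rewrite ltn_add2l ik.
  - have : rl (r := 2) (fun c : 'I_(k + k) => x c) by rewrite -(rel_iota 2 x e).
    by rewrite code_step.
pose x i := if i < k then y' i else y (i - k).
exists x; split.
- apply: (fsat_coded k _ (k + k + g') 0).2; rewrite ltnNge leq_addr addKn.
  by apply: coded_ext gy' => i ik; rewrite ltn_addr // /x ik.
- apply: (fsat_coded k _ (k + k + g) k).2; rewrite ltnNge leq_addr addKn.
  by apply: coded_ext gy => i ik; rewrite ltn_add2l ik /x ltnNge leq_addr addKn.
- suff : rl (r := 2) (fun c : 'I_(k + k) => x c) by rewrite -(rel_iota 2 x e).
  rewrite code_step; move: h; congr step_rel.
  + by apply/funext => c; rewrite /x /= ltn_ord.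
  + by apply/funext => c; rewrite /x /= ltnNge leq_addr addKn.
Qed.

Lemma fsat_certified (e : nat -> D) g y :
  fsat e (fcertified k g y) <-> certified vmem start_code step_code (e g) (e y).
Proof.
rewrite -code_mem; split=> -[a [f [ya fga h]]]; exists a, f; split=> // g0 a0 /h.
  move=> [[/fsat_start hs a0e]|[g' [a' [fg' /fsat_step hs aa]]]]; first by left.
  by right; exists g', a'.
move=> [[hs a0e]|[g' [a' [fg' hs aa]]]]; first by left; split=> //; apply/fsat_start.
by right; exists g', a'; split=> //; apply/fsat_step.
Qed.

(** Certificates give chains of codes and decoding gives chains of tuples. As a code determines its
    tuple, the tuple satisfying T is the one at the end of the chain. *)
Lemma fsat_truth (e : nat -> D) n : std vmem n (e 0) ->
  fsat e (ftruth k) <-> exists x, chain start_rel step_rel n x /\ true_rel x.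
Proof.
move=> en; have code := chain_code start_rel step_rel n _ encodes_ex encodes_inj.
split=> [[g [/fsat_certified h /fsat_true[x [gx xt]]]]|[x [xn xt]]].
  exists x; split=> //.
  have /code[x' [gx' x'n]] := (certified_chain finset_ex start_code step_code g en).1 h.
  by rewrite (encodes_inj gx gx').
have [g gx] := encodes_ex x; exists g; split; last by apply/fsat_true; exists x.
apply/fsat_certified/(certified_chain finset_ex start_code step_code g en)/code.
by exists x.
Qed.

(** Both sides unfold alike: the relativised quantifiers of n~ supply the domain conditions built
    into the chain, and [zeroE] and [succE] move the atoms from one environment to another. *)
Lemma rsat_ntilde n i (B : nat -> XN) : (forall b, rdom (B b)) ->
  rsat B (ntilde n i) <-> chain start_rel step_rel n (B i).
Proof.
have zeroE (B1 B2 : nat -> XN) i1 i2 : B1 i1 = B2 i2 ->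
    rsat B1 (Eq (Var i1) zero0) -> rsat B2 (Eq (Var i2) zero0).
  move=> BE [y [z [yd zd h1 [w [wd _ h2]] yz]]]; exists y, z; split=> //=.
    by rewrite -BE.
  by exists w; split=> // j; case: (elim0 False j).
have succE (B1 B2 : nat -> XN) i1 j1 i2 j2 : B1 i1 = B2 i2 -> B1 j1 = B2 j2 ->
    rsat B1 (S0 (Var i1) (Var j1)) -> rsat B2 (S0 (Var i2) (Var j2)).
  move=> BE BE' [z [zd h hz]]; exists z; split=> // j; have := h j.
  by case: j => [[|[|j]] jlt] //=; rewrite ?BE ?BE'.
elim: n i B => [|n IH] i B Bd.
  split=> [h|[_ h]]; last exact: zeroE h.
  by split; [apply: Bd|apply: zeroE h].
rewrite [ntilde _ _]/= rsatEx; split=> [[u [ud]]|[u [un [[ud _] us]]]].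
  rewrite rsatAnd => -[/IH un us]; exists u; split; first by apply: un => -[].
  by split; [split=> //; apply: Bd|apply: succE us].
exists u; split=> //; rewrite rsatAnd; split; last exact: succE us.
by apply/IH => // -[].
Qed.

Lemma below_ntilde n i m : i < m -> below m (ntilde n i).
Proof.
elim: n i m => [|n IH] i m im /=; rewrite ?im ?IH ?andbT //.
  by apply/forallP => j; case: (elim0 False j).
by apply/forallP => -[[|[|]]].
Qed.

Lemma sat_truth (e : nat -> W) n :
  sat e (truth N n) <-> exists x, chain start_rel step_rel n x /\ true_rel x.
Proof.
rewrite /truth sat_exs.
have envE (x : nat -> W) : (fun c : 'I_k => if c < k then x c else e (c - k)) = fun c => x c.
  by apply/funext => c; rewrite ltn_ord.
have below_n : below (1 * k) (tr N (ntilde n 0)).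
  by apply: below_tr => //; apply: below_ntilde.
have key (x : nat -> W) : rdom ((fun c : 'I_k => x c) : XN) ->
    sat (fun i => if i < k then x i else e (i - k)) (emb N (tr N (ntilde n 0))) <->
    chain start_rel step_rel n ((fun c : 'I_k => x c) : XN).
  move=> xd; pose y : XN := fun c : 'I_k => x c.
  rewrite sat_emb -(rsat_ntilde n 0 (B := fun=> y)) //.
  rewrite -(sat_tr wfN (x0 : M)) (@sat_below _ M (1 * k) _ (@flat _ _ N M wfN (fun=> y))) //.
  move=> v; rewrite mul1n => vk; rewrite vk -[v in RHS]add0n -[0 in RHS](mul0n k).
  by rewrite (@flatE _ _ N M wfN _ 0 (Ordinal vk)).
split=> [[x]|[x [xn xt]]].
  rewrite !satAnd sat_emb sat_dom envE => -[[xd /(key _ xd) xn] xt].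
  exists (fun c : 'I_k => x c); split=> //; move: xt; rewrite /= /true_rel.
  by rewrite (envE x).
have xd : rdom x.
  by case: n xn {below_n key} => [|n] => [[]//|[u [_ [[]]]]].
exists (extend x x0); rewrite !satAnd sat_emb sat_dom envE extendE; split.
  by split=> //; apply/key; rewrite extendE.
by move: xt; rewrite /= /true_rel envE extendE.
Qed.

End CodeSemantics.

(** * Truth at the rebuilt numerals *)

Section NumberTruth.
Variables (L : signature) (K : translation sig_VS L) (wfK : translation_wf K).
Local Notation N := (induced (number_tr K)).
Variables (V : struct (sig_T N)) (x0 : V).
Local Notation M := (reduct V).
Local Notation XK := (@tr_rstruct _ _ K M wfK x0).
Hypothesis domT : forall x : XK, rdom x.
Hypothesis eqnE : forall x y : XK, req x y = (x = y).
Hypothesis finset_ex : forall s : seq {classic ('I_(dim K) -> M)},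
  exists x, forall y, vmem wfK (x0 : M) y x <-> y \in s.

(** Evaluated in the quotient, n~ says that the class is the numeral n, and the elements of that
    class are the representatives of n. *)
Lemma sat_number_truth (e : nat -> V) n : sat e (truth N n) <->
  exists y, std (vmem wfK (x0 : M)) n y /\ @ri (sig_T N) V None y.
Proof.
have g := number_good domT eqnE finset_ex; have [Q [q qQ]] := quotient_exists g.
have key (E : nat -> M) : sat E (tr N (ntilde n 0)) =
    std (vmem wfK (x0 : M)) n (fun c : 'I_(dim K) => E c).
  rewrite -{1}(@blocksK _ _ _ M (number_wf wfK) E).
  rewrite (sat_induced_ntilde g qQ) => [|b]; last exact: satTop.
  exact: (number_quo_numQ domT eqnE finset_ex qQ).
have envE (x : nat -> V) :
    (fun c : 'I_(dim K) => if c < dim K then x c else e (c - dim K)) = fun c => x c.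
  by apply/funext => c; rewrite ltn_ord.
rewrite /truth sat_exs; split=> [[x]|[y [yn yt]]].
  rewrite !satAnd !sat_emb key envE => -[[_ xn] xt]; exists (fun c : 'I_(dim K) => x c).
  by split=> //; move: xt; rewrite /= envE.
exists (extend y x0); rewrite !satAnd !sat_emb key envE extendE.
split; first by split=> //; apply: satTop.
by rewrite /= envE extendE.
Qed.

End NumberTruth.

Lemma add_TB_sentence (L : signature) (U : set (form L)) (N : translation sig_Succ0 L) :
  U `<=` @sentence L -> translation_wf N -> add_TB N U `<=` @sentence (sig_T N).
Proof.
move=> Usent wfN _ [[phi /Usent phi_s <-]|[A A_s <-]]; first exact: below_emb.
have A_b : below 0 (emb N A) by apply: below_emb.
have truth_b : below 0 (truth N (godel A)).
  have [_ dom_b _ _ _] := wfN.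
  rewrite /truth below_exs addn0; apply: below_And; last by apply/forallP => c /=.
  apply: below_And; first exact: below_emb.
  by apply: below_emb; rewrite -[dim N]mul1n; apply: below_tr => //; apply: below_ntilde.
by apply: below_And; rewrite /= A_b truth_b.
Qed.

Lemma interpretation_models (L K : signature) (tau : translation L K) (V : set (form L))
    (U : set (form K)) (int : interpretation tau V U) (M : struct K) (x0 : M)
    (MU : models M U) (Q : struct L) (q : tr_rstruct int.1 x0 -> Q) :
  quotient q -> V `<=` @sentence L -> models Q V.
Proof.
move=> qQ Vsent psi Vpsi e; have /choice[B BP] i : exists x, rdom x /\ q x = e i.
  by have [x xd <-] := quo_surj qQ (e i); exists x.
have -> : e = fun i => q (B i) by apply/funext => i; case: (BP i).
rewrite -(rsat_quotient (interpretation_good int x0 MU) qQ) => [|i]; last by case: (BP i).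
by apply: interpretation_rsat (Vsent _ Vpsi) (prv_ax Vpsi).
Qed.

(** * Replacing the truth predicate inside an interpretation *)

Section TruthTransfer.
Variables (L : signature) (U : set (form L)) (K : translation sig_VS L).
Hypotheses (Usent : U `<=` @sentence L) (hK : Vaught_witness U K).
Variable N : translation sig_Succ0 L.
Hypothesis wfN : translation_wf N.
Let wfK : translation_wf K := hK.1.1.
Local Notation N' := (induced (number_tr K)).
Variable tau : translation (sig_T N) L.
Hypothesis int : interpretation tau (add_TB N U) U.

Definition truth_form : form (sig_T N) :=
  tr (code_tr N K) (compile (code_ar (dim N)) 0 (ftruth (dim N))).

(** Only T is reinterpreted, by the [tau]-translation of the formula that defines the new truth
    predicate from the old one; its arity becomes the dimension of [K]. *)
Definition transfer_tr : translation (sig_T N') L :=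
  @Translation (sig_T N') L (dim tau) (dom tau) (eqn tau) (fun f => @fct _ _ tau f)
    (fun r => match r with Some r' => rel tau (Some r') | None => tr tau truth_form end).

Lemma below_truth_form : below (dim K) truth_form.
Proof.
rewrite -[dim K]mul1n; apply: (below_tr (code_wf wfN wfK)).
exact/below_compile/fbelow_truth.
Qed.

Lemma transfer_wf : translation_wf transfer_tr.
Proof.
have [d0 dom_b eqn_b fct_b rel_b] := int.1; split=> // [[r|]]; first exact: (rel_b (Some r)).
exact: (@below_tr _ _ tau int.1 (dim K) _ below_truth_form).
Qed.

Section Model.
Variables (M : struct L) (x0 : M).
Hypothesis MU : models M U.
Local Notation X := (tr_rstruct int.1 x0).
Local Notation X' := (tr_rstruct transfer_wf x0).
Variables (W : struct (sig_T N)) (q : X -> W) (w0 : W).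
Hypothesis qW : quotient q.

Definition transfer_struct : struct (sig_T N') :=
  @Struct (sig_T N') W (fun f z => @fi (sig_T N) W f z)
    (fun r => match r as r0 return ('I_(@rar (sig_T N') r0) -> W) -> Prop with
      | Some r' => fun z => @ri (sig_T N) W (Some r') z
      | None => fun z => @sat (sig_T N) W (extend z w0) truth_form
      end).

Let gX : good X := interpretation_good int x0 MU.

Lemma flat_transfer (B : nat -> 'I_(dim tau) -> M) :
  @flat _ _ transfer_tr M transfer_wf B = flat int.1 B.
Proof. by apply/funext => v; congr (B _ _); apply: val_inj. Qed.

Let domE x : @rdom _ X' x = @rdom _ X x. Proof. by rewrite /= flat_transfer. Qed.
Let eqE x y : @req _ X' x y = @req _ X x y. Proof. by rewrite /= flat_transfer. Qed.
Let fctE f (z : 'I_(far f) -> X) y : @rfct _ X' f z y = @rfct _ X f z y.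
Proof. by rewrite /= flat_transfer. Qed.
Let relE r (z : 'I_(rar r) -> X) : @rrel _ X' (Some r) z = @rrel _ X (Some r) z.
Proof. by rewrite /= flat_transfer. Qed.

Lemma rrel_transfer (z : 'I_(dim K) -> X) : (forall j, rdom (z j)) ->
  @rrel _ X' None z = @sat (sig_T N) W (extend (fun j => q (z j)) w0) truth_form.
Proof.
move=> zd; have [x xd xw] := quo_surj qW w0.
change (sat (flat transfer_wf (extend z (fun=> x0))) (tr tau truth_form) =
  sat (extend (fun j => q (z j)) w0) truth_form).
rewrite flat_transfer (sat_tr int.1 x0).
rewrite (@rsat_below _ X (dim K) _ (extend z x)) ?below_truth_form // => [|i id]; last first.
  by rewrite !extend_lt.
rewrite (rsat_quotient gX qW) => [|i]; last by rewrite /extend; case: insubP.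
congr sat; apply/funext => i; rewrite /extend; case: insubP => //.
Qed.

Lemma transfer_good : good X'.
Proof.
have [inh refl eucl tot fct rel] := gX; split.
- by have [x xd] := inh; exists x; rewrite domE.
- by move=> x; rewrite domE eqE; apply: refl.
- by move=> x y z; rewrite !domE !eqE; apply: eucl.
- move=> f z zd; have [|y [yd zy]] := tot f z; first by move=> j; rewrite -domE.
  by exists y; rewrite domE fctE.
- move=> f z z' y y' zd zd' yd yd' zz'; rewrite eqE !fctE => zy zy'.
  by apply: (fct f z z' y y') => *; rewrite -?domE -?eqE.
- case=> [r|] z z' zd zd' zz'.
    by rewrite !relE; apply: rel => *; rewrite -?domE -?eqE.
  rewrite !rrel_transfer => [|j|j]; rewrite -?domE //.
  have -> // : (fun j => q (z j)) = fun j => q (z' j).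
  by apply/funext => j; rewrite (quo_eq qW) -?domE -?eqE.
Qed.

Lemma transfer_quotient : @quotient _ X' transfer_struct q.
Proof.
split.
- by move=> c; have [x xd <-] := quo_surj qW c; exists x; rewrite ?domE.
- by move=> x y; rewrite !domE eqE; apply: quo_eq.
- move=> f z y zd yd; rewrite fctE => /(quo_fct qW) -> // => [j|]; by rewrite -domE.
- case=> [r|] z zd.
    by rewrite relE -(quo_rel qW) // => j; rewrite -domE.
  by rewrite rrel_transfer // => j; rewrite -domE.
Qed.

(** At the numeral for [A], both truth predicates say that the old T holds at the end of a chain in
    [N] of length [godel A]. The biconditional for [A] is thereby inherited from the old one. *)
Lemma transfer_models : models transfer_struct (add_TB N' U).
Proof.
have WV := interpretation_models MU qW (add_TB_sentence Usent wfN).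
have RU : models (reduct W) U.
  by move=> psi Upsi e; rewrite -sat_emb; apply: WV; left; exists psi.
have domT := @witness_domT _ _ _ hK.1 hK.2 (reduct W) w0 RU.
have eqnE := @witness_eqnE _ _ _ hK.1 hK.2 (reduct W) w0 RU.
have finset_ex := @witness_finset _ _ _ hK.1 hK.2 (reduct W) w0 RU.
move=> _ [[psi Upsi <-]|[A As <-]] e; first by rewrite sat_emb; apply: RU.
have := WV (Iff (emb N A) (truth N (godel A))) _ e.
rewrite satIff sat_emb => AT; rewrite satIff sat_emb.
apply: (iff_trans (AT _)); first by right; exists A.
apply: (iff_trans (sat_truth wfN (w0 : reduct W) e _)).
apply: iff_sym.
apply: (iff_trans (@sat_number_truth _ K wfK transfer_struct w0 domT eqnE finset_ex e _)).
(* The right-hand side does not mention [y], so all representatives of the numeral get the same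
   truth value. *)
have truthE y : std (vmem wfK (w0 : reduct W)) (godel A) y ->
    @sat (sig_T N) W (extend y w0) truth_form <->
    exists x, chain (@start_rel _ _ wfN W w0) (@step_rel _ _ wfN W w0) (godel A) x /\ true_rel x.
  move=> yn; rewrite -(blocksK (code_wf wfN wfK) (extend y w0)).
  rewrite (@sat_tr_direct _ _ _ _ (code_wf wfN wfK) W w0 (@code_domT _ _ _ wfN wfK W w0 domT)
    (@code_eqnE _ _ _ wfN wfK W w0 eqnE)) sat_compile //.
  apply: (fsat_truth wfN finset_ex).
  suff yE : @blocks _ _ (code_tr N K) W (extend y w0) 0 = y by rewrite yE.
  by apply/funext => c; rewrite /blocks mul0n add0n extend_ord.
have [y0 y0n] := std_ex finset_ex (godel A).
split=> [[y [yn /(truthE y yn)]]//|h]; exists y0; split=> //.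
exact/(truthE y0 y0n).
Qed.

End Model.

Lemma interpretation_transfer : interpretation transfer_tr (add_TB N' U) U.
Proof.
apply: (interpretation_intro Usent (wf := transfer_wf)) => M x0 MU.
have gX := interpretation_good int x0 MU; have [W [q qW]] := quotient_exists gX.
have [x _] := good_inh gX.
split; first exact: (transfer_good MU (q x) qW).
exists (transfer_struct (q x)), q; split; first exact: (transfer_quotient MU (q x) qW).
exact: (transfer_models MU qW).
Qed.

End TruthTransfer.

Theorem theorem3p5 (L : signature) (U : set (form L))
    (hU : U `<=` @sentence L) (hV : Vaught U) :
  ((exists N : translation sig_Succ0 L,
      interpretation N Succ0 U /\ Enayat U N)
   <->
   (exists N : translation sig_R L,
      interpretation N TheoryR U /\ interprets U (add_TB (induced N) U)))
  /\
  (forall K : translation sig_VS L, Vaught_witness U K ->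
     (exists N : translation sig_Succ0 L,
        interpretation N Succ0 U /\ Enayat U N) ->
     exists N : translation sig_R L,
       [/\ interpretation N TheoryR U,
           interprets U (add_TB (induced N) U)
         & dim N = dim K]).
Proof.
(* Besides the claim on dimensions, this gives the forward direction of the equivalence, applied to
   any witness that [U] is Vaught. *)
have main K : Vaught_witness U K ->
    (exists N : translation sig_Succ0 L, interpretation N Succ0 U /\ Enayat U N) ->
    exists N : translation sig_R L, [/\ interpretation N TheoryR U,
      interprets U (add_TB (induced N) U) & dim N = dim K].
  move=> hK [N [[wfN _] [tau int]]]; exists (number_tr K); split=> //.
    exact: interpretation_number.
  by exists (transfer_tr K tau); apply: interpretation_transfer.
split=> //; split=> [hN|[N [int hN]]].
  by have [K hK] := hV; have [N [? ? _]] := main K hK hN; exists N.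
by exists (induced N); split=> //; apply: interpretation_induced.
Qed.
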